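(* Let $m\ge 1$, let $(\mathbf R,\mathbf d)$ be a metric space, let $r=(r_1,\dots,r_m)\in(]1,+\infty])^m$ and let $\phi:(a,x)\mapsto\phi(a,x)\in\mathbb C$ be a continuous function on $\big(\prod_{j=1}^m]-r_j,r_j[\big)\times\mathbf R$. Let $\mathbb D^m_r=\{w\in\mathbb C^m: |w_j|<r_j\text{ for }j=1,\dots,m\}$. Suppose that there exists a continuous map $x\mapsto f_x$ from $\mathbf R$ to $H(\mathbb D^m_r)$ such that for each $x\in\mathbf R$ the function $a\mapsto\phi(a,x)$ on $\prod_{j=1}^m]-r_j,r_j[$ is the restriction of $w\mapsto f_x(w)$ to $\prod_{j=1}^m]-r_j,r_j[$. Then $$\phi(a,x)=\lim_{\{N\in(\mathbb N^* )^m:\ \min_j N_j\to+\infty\}}\ \sum_{\nu\prec N}\binom{N}{\nu}\Big(\frac{1-a}{2}\Big)^{\nu}\Big(\frac{1+a}{2}\Big)^{N-\nu}\phi\Big(\mathbf 1-2\frac{\nu}{N},x\Big)$$ uniformly in $(a,x)$ on any compact subset of $\big(\prod_{j=1}^m]-r_j,r_j[\big)\times\mathbf R$.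
   Context: $\mathbb N^*$ is the set of positive integers. $H(U)$ denotes the space of holomorphic functions on the open set $U$, with the topology of uniform convergence on compact subsets. For $N=(N_1,\dots,N_m)\in(\mathbb N^* )^m$ and $\nu\in\mathbb N^m$, $\nu\prec N$ means $0\le\nu_j\le N_j$ for all $j$; $\mathbf 1-2\nu/N:=(1-2\nu_1/N_1,\dots,1-2\nu_m/N_m)\in[-1,1]^m$; and $$\binom{N}{\nu}\Big(\frac{1-a}{2}\Big)^{\nu}\Big(\frac{1+a}{2}\Big)^{N-\nu}:=\prod_{j=1}^m\binom{N_j}{\nu_j}\Big(\frac{1-a_j}{2}\Big)^{\nu_j}\Big(\frac{1+a_j}{2}\Big)^{N_j-\nu_j}.$$ *)

(* Defs.v *)
From HB Require Import structures.
From mathcomp Require Import all_boot all_order all_algebra.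
From mathcomp Require Import all_classical all_reals all_analysis.
From mathcomp.real_closed Require Import complex.

Set Implicit Arguments.
Unset Strict Implicit.
Unset Printing Implicit Defensive.

Import Order.TTheory GRing.Theory Num.Theory.
Import numFieldNormedType.Exports.

Local Open Scope classical_set_scope.
Local Open Scope ring_scope.

(* R[i] itself carries no topology in the library; seen as an abstract
   numClosedFieldType it gets the one defined by its norm. *)
Definition Cx (R : realType) : numClosedFieldType := R[i].

Definition toCx (R : realType) (t : R) : Cx R := real_complex R t.

Definition real_box (R : realType) (m : nat) (r : 'I_m -> \bar R) :
    set 'rV[R]_m :=
  [set a | forall j, (- r j < (a ord0 j)%:E < r j)%E].

Definition polydisc (R : realType) (m : nat) (r : 'I_m -> \bar R) :
    set 'rV[Cx R]_m :=
  [set w | forall j, ((Normc.normc (w ord0 j))%:E < r j)%E].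

(* Only meant for open U; the values of f outside U are then irrelevant. *)
Definition holomorphic_on (R : realType) (m : nat) (U : set 'rV[Cx R]_m)
    (f : 'rV[Cx R]_m -> Cx R) : Prop :=
  forall w, U w -> differentiable f w.

Definition compact_in (T : topologicalType) (U : set T) : set (set T) :=
  [set K | compact K /\ K `<=` U].

(* H(U), for U open, is rendered as the set of [f] satisfying
   [holomorphic_on U f] in this space of total functions, whose topology
   (uniform convergence on the compact subsets of U) does not see the values
   outside U. *)
Notation compact_cvg_space R m U :=
  {family compact_in U, 'rV[Cx R]_m -> Cx R}.

(* The filter "min_j N_j -> +oo" on multi-indices N with all N_j >= 1. *)
Definition min_infty (m : nat) : set_system ('I_m -> nat) :=
  filter_from [set: nat]
    (fun n => [set N | forall j, (0 < N j)%N /\ (n <= N j)%N]).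

Definition bernstein_node (R : realType) (m : nat) (N nu : 'I_m -> nat) :
    'rV[R]_m :=
  \row_j (1 - 2 * ((nu j)%:R / (N j)%:R)).

Definition binomial_weight (R : realType) (m : nat) (N nu : 'I_m -> nat)
    (a : 'rV[R]_m) : R :=
  \prod_j ('C(N j, nu j)%:R * ((1 - a ord0 j) / 2) ^+ nu j
           * ((1 + a ord0 j) / 2) ^+ (N j - nu j)).

Definition bernstein_sum (R : realType) (m : nat) (X : Type)
    (phi : 'rV[R]_m * X -> Cx R) (N : 'I_m -> nat) (p : 'rV[R]_m * X) : Cx R :=
  \sum_(nu : {dffun forall j : 'I_m, 'I_(N j).+1})
     toCx (binomial_weight N (fun j => nu j) p.1)
     * phi (bernstein_node R N (fun j => nu j), p.2).

(* Main.v *)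
Require Import Defs.
From HB Require Import structures.
From mathcomp Require Import all_boot all_order all_algebra.
From mathcomp Require Import all_classical all_reals all_analysis.
From mathcomp.real_closed Require Import complex.
From mathcomp Require Import ring lra.

Set Implicit Arguments.
Unset Strict Implicit.
Unset Printing Implicit Defensive.

Import Order.TTheory GRing.Theory Num.Theory.
Import numFieldNormedType.Exports.

Local Open Scope classical_set_scope.
Local Open Scope ring_scope.

(** The Bernstein operator applied to f and evaluated at a, minus f(a), is a
    linear functional L of f that only involves the values of f at finitely
    many points of the closed polydisc of polyradius rho, where rho_j >= 1
    bounds |a_j| and the nodes lie in [-1, 1]^m. Pick rho_j < s_j < r_j. By
    Cauchy's formula in each variable, each value f(w) is the mean, over the
    torus |u_j| = s_j, of f(u) prod_j 1 / (1 - w_j / u_j); hence |L f| is at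
    most the supremum of |f| over the torus times the supremum over u of the
    value of |L| at the product of kernels (polydisc_sup). The first factor is
    bounded for parameters x in a compact set, because x |-> f_x is continuous
    for uniform convergence on the torus (compact_family_bounded). The second
    one has nothing to do with f any more and must be shown to tend to 0.

    Weights and kernels factor over the variables, so it is enough to treat
    one variable (bernstein_kernel_prod). There the kernel is the geometric
    series of the monomials w^k / u^k. The Bernstein operator maps w^k to the
    moment E[(S / n)^k], where S is a sum of n independent signs of mean a,
    in the formal sense that the weights need not be positive when |a| > 1.
    Comparing S with its last summand gives a recursion for the errors
    |E[(S / n)^k] - a^k|, whose source term is O(k rho^k / n)
    (bmoment_step). Divided by s^k the errors satisfy a contraction of ratio
    rho / s, and their sum over k is O(1 / n) (bernstein_kernel).

    Cauchy's formula is needed for functions that are merely complex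
    differentiable at each point. It rests on Goursat's lemma for rectangles
    in the logarithmic plane zeta = x + i y, mapped onto annuli by exp: the
    horizontal sides of a rectangle of height 2 pi cancel by periodicity, so
    the mean of H over the circle of radius t does not depend on t as long as
    the annulus avoids the points where H is not differentiable. For
    H(z) = z (g(z) - g(p)) / (z - p) the only such point is p, where H is
    continuous; crossing the radius |p| by continuity, the mean of H is
    H(0) = 0 (circle_mean), which is Cauchy's formula for g at p
    (cauchy_circle). *)

(** * Complex numbers with a real-valued modulus *)

(** Spelling out the codomain keeps the modulus real-valued: on a product or
    an inverse, inference would settle on the modulus with values in R[i]. *)
Notation cmod z := (Num.norm (z : Rcomplex _)).

Local Notation Re := (@complex.Re _).
Local Notation Im := (@complex.Im _).

Section Complex_modulus.
Variable R : realType.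
Local Notation K := (Rcomplex R).
Implicit Types z w : K.

Lemma modM z w : cmod (z * w) = cmod z * cmod w.
Proof. exact: Normc.normcM. Qed.

Lemma modV z : cmod (z^-1) = (cmod z)^-1.
Proof. exact: Normc.normcV. Qed.

Lemma mod1 : cmod (1 : K) = 1.
Proof. exact: Normc.normc1. Qed.

Lemma modX z n : cmod (z ^+ n) = cmod z ^+ n.
Proof. by elim: n => [|n IH]; rewrite ?expr0 ?mod1 // !exprS modM IH. Qed.

Lemma modE z : cmod z = Num.sqrt (Re z ^+ 2 + Im z ^+ 2).
Proof. by case: z. Qed.

Lemma modR (x : R) : cmod x%:C%C = `|x|.
Proof. by rewrite modE /= expr0n /= addr0 sqrtr_sqr. Qed.

Lemma mod_conj z : cmod (z^*)%C = cmod z.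
Proof. by case: z => a b; rewrite !modE /= sqrrN. Qed.

Lemma Re_le_mod z : `|Re z| <= cmod z.
Proof. by rewrite modE -sqrtr_sqr ler_wsqrtr // lerDl sqr_ge0. Qed.

Lemma Im_le_mod z : `|Im z| <= cmod z.
Proof. by rewrite modE -sqrtr_sqr ler_wsqrtr // lerDr sqr_ge0. Qed.

Lemma mod_le_ReIm z : cmod z <= `|Re z| + `|Im z|.
Proof.
case: z => a b.
rewrite -[X in cmod X](_ : (a +i* 0 + 0 +i* b)%C = _); last first.
  by congr Complex; rewrite ?addr0 ?add0r.
apply: (le_trans (ler_normD _ _)).
by rewrite !modE /= expr0n /= addr0 add0r !sqrtr_sqr.
Qed.

Lemma cplxD (a b c d : R) :
  Complex a b + Complex c d = Complex (a + c) (b + d) :> K.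
Proof. by []. Qed.

Lemma cplxN (a b : R) : - Complex a b = Complex (- a) (- b) :> K.
Proof. by []. Qed.

Lemma cplxM (a b c d : R) :
  Complex a b * Complex c d = Complex (a * c - b * d) (a * d + b * c) :> K.
Proof. by []. Qed.

Lemma sqr_mod z : ((cmod z ^+ 2)%:C)%C = z * (z^*)%C :> K.
Proof.
case: z => a b; rewrite modE sqr_sqrtr ?addr_ge0 ?sqr_ge0 //=.
by rewrite cplxM; congr Complex; ring.
Qed.

End Complex_modulus.

Ltac cplx_ring :=
  rewrite /real_complex_def ?(cplxM, cplxN, cplxD); congr Complex; ring.


(** * Continuity at a point *)

Section Pointwise_continuity.
Variable R : realType.

(** An epsilon-delta definition, because Rcomplex R carries an R-valued norm but
    no topology. *)
Definition ptcont (V W : normedZmodType R) (h : V -> W) (x : V) :=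
  forall e : R, 0 < e ->
  exists2 d : R, 0 < d & forall y, `|y - x| < d -> `|h y - h x| < e.

Section Rules.
Variables V W : normedZmodType R.
Implicit Types h g : V -> W.

Lemma ptcont_cst (c : W) x : ptcont (fun _ : V => c) x.
Proof. by move=> e e0; exists 1 => // y _; rewrite subrr normr0. Qed.

Lemma ptcont_lip h x (k : R) :
  (forall y, `|h y - h x| <= k * `|y - x|) -> ptcont h x.
Proof.
move=> hk e e0; have k1 : 0 < `|k| + 1 by rewrite ltr_wpDl.
exists (e / (`|k| + 1)); first exact: divr_gt0.
move=> y; rewrite ltr_pdivlMr // => yx; apply: le_lt_trans (hk y) _.
apply: le_lt_trans yx; rewrite mulrC ler_wpM2l //.
by have := ler_norm k; lra.
Qed.

Lemma ptcontD h g x : ptcont h x -> ptcont g x -> ptcont (fun y => h y + g y) x.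
Proof.
move=> ch cg e e0; have e20 : 0 < e / 2 by lra.
have [d1 d10 h1] := ch _ e20; have [d2 d20 h2] := cg _ e20.
exists (Num.min d1 d2); first by rewrite lt_min d10.
move=> y; rewrite lt_min => /andP[/h1 {}h1 /h2 {}h2].
rewrite opprD addrACA; apply: le_lt_trans (ler_normD _ _) _; lra.
Qed.

Lemma ptcontN h x : ptcont h x -> ptcont (fun y => - h y) x.
Proof.
move=> ch e /ch[d d0 hd]; exists d => // y /hd.
by rewrite -opprD normrN.
Qed.

Lemma ptcontB h g x : ptcont h x -> ptcont g x -> ptcont (fun y => h y - g y) x.
Proof. by move=> ch cg; apply: ptcontD => //; exact: ptcontN. Qed.

Lemma eq_ptcont h g x (d : R) : 0 < d ->
  (forall y, `|y - x| < d -> h y = g y) ->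
  ptcont h x -> ptcont g x.
Proof.
move=> d0 hg ch e /ch[d' d'0 hd]; exists (Num.min d d').
  by rewrite lt_min d0.
move=> y; rewrite lt_min => /andP[yd /hd]; rewrite (hg _ yd) hg //.
by rewrite subrr normr0.
Qed.

End Rules.

Lemma ptcont_comp (V W U : normedZmodType R) (g : V -> W) (h : W -> U) x :
  ptcont g x -> ptcont h (g x) -> ptcont (fun y => h (g y)) x.
Proof.
by move=> cg ch e /ch[d /cg[d' d'0 gd] hd]; exists d' => // y /gd /hd.
Qed.

Local Notation K := (Rcomplex R).

Lemma ptcontM (V : normedZmodType R) (h g : V -> K) x :
  ptcont h x -> ptcont g x -> ptcont (fun y => h y * g y) x.
Proof.
move=> ch cg e e0.
set M := `|h x| + `|g x| + 1.
have M0 : 0 < M by rewrite ltr_wpDl // addr_ge0.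
have e1 : 0 < Num.min 1 (e / M / 2) by rewrite lt_min ltr01 !divr_gt0.
have [d1 d10 h1] := ch _ e1; have [d2 d20 h2] := cg _ e1.
exists (Num.min d1 d2); first by rewrite lt_min d10.
move=> y; rewrite lt_min => /andP[/h1 {}h1 /h2 {}h2].
have -> : h y * g y - h x * g x =
  (h y - h x) * (g y - g x) + (h y - h x) * g x + h x * (g y - g x) by ring.
move: h1 h2; rewrite !lt_min => /andP[u1 u2] /andP[v1 v2].
have {}u2 : `|h y - h x| * M < e / 2 by rewrite -ltr_pdivlMr // mulrAC.
have {}v2 : `|g y - g x| * M < e / 2 by rewrite -ltr_pdivlMr // mulrAC.
apply: le_lt_trans (ler_normD _ _) _.
apply: le_lt_trans (lerD (ler_normD _ _) (lexx _)) _; rewrite !modM.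
have := normr_ge0 (h y - h x); have := normr_ge0 (g y - g x).
move: u1 u2 v1 v2; rewrite /M; set u := `|_ - _|; set v := `|_ - _|.
have := normr_ge0 (h x); have := normr_ge0 (g x).
set a := `|h x|; set b := `|g x| => *; nra.
Qed.

Lemma ptcontV (V : normedZmodType R) (g : V -> K) x :
  ptcont g x -> g x != 0 -> ptcont (fun y => (g y)^-1) x.
Proof.
move=> cg gx0; have G : 0 < `|g x| by rewrite normr_gt0.
move=> e e0; have : 0 < Num.min (`|g x| / 2) (e * `|g x| ^+ 2 / 2).
  by rewrite lt_min !divr_gt0 ?mulr_gt0 ?exprn_gt0.
move=> /cg[d d0 gd]; exists d => // y /gd.
rewrite lt_min => /andP[y1 y2].
have gy : `|g x| / 2 < `|g y|.
  have := ler_normB (g y) (g y - g x).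
  by rewrite opprB addrC subrK => ?; lra.
have gy0 : g y != 0 by rewrite -normr_gt0; lra.
have -> : (g y)^-1 - (g x)^-1 = - (g y - g x) * (g y)^-1 * (g x)^-1.
  by field; rewrite gx0 gy0.
rewrite !modM !modV normrN -mulrA -invfM ltr_pdivrMr ?mulr_gt0 //; last lra.
apply: lt_le_trans y2 _; rewrite -mulrA ler_pM2l //; move: gy G; nra.
Qed.

Lemma ptcont_Re (V : normedZmodType R) (h : V -> K) x :
  ptcont h x -> ptcont (fun y => Re (h y)) x.
Proof.
move=> ch e /ch[d d0 hd]; exists d => // y /hd; apply: le_lt_trans.
by rewrite -(raddfB (@complex.Re R : K -> R)) Re_le_mod.
Qed.

Lemma ptcont_Im (V : normedZmodType R) (h : V -> K) x :
  ptcont h x -> ptcont (fun y => Im (h y)) x.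
Proof.
move=> ch e /ch[d d0 hd]; exists d => // y /hd; apply: le_lt_trans.
by rewrite -(raddfB (@complex.Im R : K -> R)) Im_le_mod.
Qed.

Lemma ptcont_continuous (h : R -> R) x : ptcont h x <-> {for x, continuous h}.
Proof.
split=> [ch|/cvgrPdist_lt ch].
  apply/cvgrPdist_lt => e /ch[d d0 hd]; near=> y; rewrite distrC; apply: hd.
  by near: y; rewrite /=; exists d => //= y; rewrite distrC.
move=> e /ch[d d0 hd]; exists d => // y yx; rewrite distrC; apply: hd.
by rewrite /= distrC.
Unshelve. all: by end_near. Qed.

End Pointwise_continuity.

(** * Integrals of complex functions of a real variable *)

Section Complex_integral.
Variable R : realType.
Local Notation K := (Rcomplex R).
Local Notation mu := (@lebesgue_measure R).
Implicit Types (a b c : R) (h g : R -> K).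

Definition cint a b h : K :=
  Complex (\int[mu]_(x in `[a, b]) Re (h x)) (\int[mu]_(x in `[a, b]) Im (h x)).

Definition icont a b h := forall x, a <= x <= b -> ptcont h x.

Lemma ptcont_integrable a b (u : R -> R) :
  (forall x, a <= x <= b -> ptcont u x) ->
  mu.-integrable `[a, b] (EFin \o u).
Proof.
move=> cu; apply: continuous_compact_integrable; first exact: segment_compact.
apply: continuous_in_subspaceT => x /set_mem /=; rewrite in_itv /=.
by move=> /cu/ptcont_continuous.
Qed.

Lemma icont_Re a b h : icont a b h ->
  mu.-integrable `[a, b] (EFin \o (fun x => Re (h x))).
Proof.
by move=> ch; apply: ptcont_integrable => x /ch; exact: ptcont_Re.
Qed.

Lemma icont_Im a b h : icont a b h ->
  mu.-integrable `[a, b] (EFin \o (fun x => Im (h x))).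
Proof.
by move=> ch; apply: ptcont_integrable => x /ch; exact: ptcont_Im.
Qed.

Lemma eq_cint a b h g : (forall x, a <= x <= b -> h x = g x) ->
  cint a b h = cint a b g.
Proof.
by move=> hg; congr Complex; apply: eq_Rintegral => x /set_mem /=;
  rewrite in_itv /= => /hg ->.
Qed.

Lemma cintD a b h g : icont a b h -> icont a b g ->
  cint a b (fun x => h x + g x) = cint a b h + cint a b g.
Proof.
move=> ch cg; congr Complex; rewrite -RintegralD //;
  try exact: icont_Re; try exact: icont_Im; apply: eq_Rintegral => x _.
- exact: (raddfD (@complex.Re R : K -> R)).
- exact: (raddfD (@complex.Im R : K -> R)).
Qed.

Lemma cintZ a b (k : K) h : icont a b h ->
  cint a b (fun x => k * h x) = k * cint a b h.
Proof.
move=> ch; have [iR iI] := (icont_Re ch, icont_Im ch).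
case: k => k l; rewrite /cint /GRing.mul /=; congr Complex.
- rewrite -!RintegralZl // -RintegralB //.
  + by apply: eq_Rintegral => x _; case: (h x).
  + exact: (integrableZl _ k iR).
  + exact: (integrableZl _ l iI).
- rewrite -!RintegralZl // -RintegralD //.
  + by apply: eq_Rintegral => x _; case: (h x).
  + exact: (integrableZl _ k iI).
  + exact: (integrableZl _ l iR).
Qed.

Lemma cintB a b h g : icont a b h -> icont a b g ->
  cint a b (fun x => h x - g x) = cint a b h - cint a b g.
Proof.
move=> ch cg; rewrite cintD //; last by move=> x /cg; exact: ptcontN.
congr (_ + _); rewrite -mulN1r -cintZ //.
by apply: eq_cint => x _; rewrite mulN1r.
Qed.

Lemma cint_conj a b h : icont a b h ->
  cint a b (fun x => (h x)^*%C) = ((cint a b h)^*)%C.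
Proof.
move=> ch; congr Complex; first by apply: eq_Rintegral => x _; case: (h x).
rewrite -mulN1r -RintegralZl //; last exact: icont_Im.
by apply: eq_Rintegral => x _; case: (h x) => ? ? /=; rewrite mulN1r.
Qed.

Lemma cint_cst a b (k : K) : a <= b -> cint a b (fun=> k) = k * (b - a)%:C%C.
Proof.
move=> ab; transitivity (cint a b (fun=> k * 1)).
  by apply: eq_cint => x _; rewrite mulr1.
rewrite cintZ; last by move=> x _; exact: ptcont_cst.
congr (_ * _); congr Complex; last by rewrite Rintegral_cst // mul0r.
rewrite Rintegral_cst // mul1r.
apply: etrans (congr1 fine (@lebesgue_measure_itv R `[a, b])) _.
by rewrite /= lte_fin; case: ltgtP ab => // ->; rewrite subrr.
Qed.

Lemma cint_split a b c h : a <= b <= c -> icont a c h ->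
  cint a c h = cint a b h + cint b c h.
Proof.
move=> /andP[ab bc] ch.
have key (u : R -> R) : (forall x, a <= x <= c -> ptcont u x) ->
    \int[mu]_(x in `[a, c]) u x =
    \int[mu]_(x in `[a, b]) u x + \int[mu]_(x in `[b, c]) u x.
  move=> cu; apply/eqP; rewrite addrC -subr_eq; apply/eqP.
  rewrite Rintegral_itvB ?bnd_simp //; last exact: ptcont_integrable.
  apply: Rintegral_itv_obnd_cbnd.
  apply: (@integrableS _ _ _ mu `[a, c]) => //; last exact: ptcont_integrable.
  by apply: subset_itv; rewrite bnd_simp.
by congr Complex; apply: key => x /ch; [exact: ptcont_Re|exact: ptcont_Im].
Qed.

(** Rotating the integrand by the conjugate of the integral makes the integral
    real, where the bound is monotonicity; this yields the constant 1. *)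
Lemma cint_le a b h (M : R) : a <= b -> icont a b h ->
  (forall x, a <= x <= b -> `|h x| <= M) -> `|cint a b h| <= M * (b - a).
Proof.
move=> ab ch hM; set v := cint a b h.
have M0 : 0 <= M by apply: le_trans (hM a _) => //; rewrite lexx.
have [->|v0] := eqVneq v 0; first by rewrite normr0 mulr_ge0 // subr_ge0.
have {}v0 : 0 < `|v| by rewrite normr_gt0.
rewrite -(ler_pM2l v0) -expr2.
have -> : `|v| ^+ 2 = Re (cint a b (fun x => (v^*)%C * h x)).
  by rewrite cintZ // mulrC -sqr_mod.
have ch' : icont a b (fun x => (v^*)%C * h x).
  by move=> x /ch; apply: ptcontM; exact: ptcont_cst.
have -> : `|v| * (M * (b - a)) = \int[mu]_(x in `[a, b]) (`|v| * M).
  have /(congr1 (@complex.Re R)) := cint_cst (`|v| * M)%:C%C ab.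
  by rewrite /= => ->; ring.
apply: le_Rintegral => //; first exact: icont_Re.
  by apply: ptcont_integrable => x _; exact: ptcont_cst.
move=> x /=; rewrite in_itv /= => abx.
apply: le_trans (ler_norm _) _; apply: le_trans (Re_le_mod _) _.
have modJM (z w : K) : cmod ((z^*)%C * w) = cmod z * cmod w.
  by rewrite modM mod_conj.
apply: (@le_trans _ _ (cmod v * cmod (h x))); last by rewrite ler_wpM2l // hM.
by rewrite -modJM.
Qed.

End Complex_integral.

(** * Bisection of rectangles *)

Section Bisection.
Variable R : realType.
Implicit Types a b c d x y : R.

Lemma nested_intervals (A B : nat -> R) :
  (forall n, A n <= A n.+1) -> (forall n, B n.+1 <= B n) ->
  (forall n, A n <= B n) -> exists x, forall n, A n <= x <= B n.
Proof.
move=> Aup Bdn AB.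
have Amon : {homo A : m n / (m <= n)%N >-> m <= n}.
  exact: homo_leq lexx le_trans Aup.
have Bmon : {homo B : m n / (m <= n)%N >-> n <= m}.
  by apply: homo_leq => // ? ? ? xy yz; exact: le_trans yz xy.
have ABmn m n : A m <= B n.
  apply: le_trans (Amon _ _ (leq_maxl m n)) _.
  exact: le_trans (AB _) (Bmon _ _ (leq_maxr m n)).
have ubA n : ubound (range A) (B n) by move=> _ [m _ <-].
have neA : range A !=set0 by exists (A 0); exists 0%N.
exists (sup (range A)) => n; apply/andP; split; last exact: ge_sup (ubA n).
by apply: ub_le_sup; [exists (B 0); exact: ubA|exists n].
Qed.

(** A bad rectangle has a bad quarter; iterating, bad rectangles shrink to a
    point, where the local hypothesis rules them out. *)
Lemma rect_bisection (good : R -> R -> R -> R -> Prop) a b c d :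
  a <= b -> c <= d ->
  (forall a b c d, a <= b -> c <= d ->
    let m := (a + b) / 2 in let n := (c + d) / 2 in
    good a m c n -> good m b c n -> good a m n d -> good m b n d ->
    good a b c d) ->
  (forall x y, a <= x <= b -> c <= y <= d ->
    exists2 e : R, 0 < e & forall a' b' c' d',
      a <= a' <= x -> x <= b' <= b -> c <= c' <= y -> y <= d' <= d ->
      b' - a' < e -> d' - c' < e -> good a' b' c' d') ->
  good a b c d.
Proof.
move=> ab cd split_good loc; apply: contrapT => bad0.
pose Q := (R * R * (R * R))%type.
pose bad (q : Q) := [/\ q.1.1 <= q.1.2, q.2.1 <= q.2.2
  & ~ good q.1.1 q.1.2 q.2.1 q.2.2].
pose half (p p' : R * R) := [/\ p.1 <= p'.1, p'.2 <= p.2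
  & p'.2 - p'.1 = (p.2 - p.1) / 2].
have next (q : {q : Q | bad q}) :
    {q' : {q : Q | bad q} | half (sval q).1 (sval q').1 /\
                            half (sval q).2 (sval q').2}.
  case: q => [[[a1 b1] [c1 d1]] [/= ab1 cd1 nq]]; apply: cid.
  apply: contrapT => none; apply: nq.
  have quarter (p p' : R * R) : p.1 <= p.2 -> p'.1 <= p'.2 ->
      half (a1, b1) p -> half (c1, d1) p' -> good p.1 p.2 p'.1 p'.2.
    move=> h1 h2 h3 h4; apply: contrapT => ng; apply: none.
    by exists (exist _ (p, p') (And3 h1 h2 ng)).
  have halves (u v : R) : u <= v -> [/\ u <= (u + v) / 2, (u + v) / 2 <= v,
      half (u, v) (u, (u + v) / 2) & half (u, v) ((u + v) / 2, v)].
    by move=> uv; split; [lra|lra|split => /=; lra|split => /=; lra].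
  have [xl xr xL xR] := halves _ _ ab1; have [yl yr yL yR] := halves _ _ cd1.
  apply: split_good => //=.
  - exact: (quarter (_, _) (_, _) xl yl).
  - exact: (quarter (_, _) (_, _) xr yl).
  - exact: (quarter (_, _) (_, _) xl yr).
  - exact: (quarter (_, _) (_, _) xr yr).
pose q0' : {q : Q | bad q} := exist _ ((a, b), (c, d)) (And3 ab cd bad0).
pose s n := iter n (fun q => sval (next q)) q0'.
have sS n : half (sval (s n)).1 (sval (s n.+1)).1 /\
            half (sval (s n)).2 (sval (s n.+1)).2 := svalP (next (s n)).
have [x xP] : exists x, forall n, (sval (s n)).1.1 <= x <= (sval (s n)).1.2.
  by apply: nested_intervals => n; [case: (sS n) => -[]|case: (sS n) => -[]|
    case: (svalP (s n))].
have [y yP] : exists y, forall n, (sval (s n)).2.1 <= y <= (sval (s n)).2.2.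
  by apply: nested_intervals => n; [case: (sS n) => _ []|case: (sS n) => _ []|
    case: (svalP (s n))].
have inside n : [/\ a <= (sval (s n)).1.1, (sval (s n)).1.2 <= b,
    c <= (sval (s n)).2.1 & (sval (s n)).2.2 <= d].
  elim: n => [|n [i1 i2 i3 i4]]; first by split.
  have [[u1 u2 _] [v1 v2 _]] := sS n.
  by split; [exact: le_trans u1|exact: le_trans i2|exact: le_trans v1|
    exact: le_trans i4].
have width n : (sval (s n)).1.2 - (sval (s n)).1.1 = (b - a) / 2 ^+ n /\
               (sval (s n)).2.2 - (sval (s n)).2.1 = (d - c) / 2 ^+ n.
  elim: n => [|n [w1 w2]]; first by rewrite expr0 !divr1.
  have [[_ _ u] [_ _ v]] := sS n.
  by rewrite u v w1 w2 exprSr invfM !mulrA.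
have /andP[ax xb] := xP 0%N; have /andP[cy yd] := yP 0%N.
have [e e0 small] := loc x y (xP 0%N) (yP 0%N).
pose n := Num.bound (((b - a) + (d - c)) / e).
have nbig : (b - a) + (d - c) < e * 2 ^+ n.
  rewrite mulrC -ltr_pdivrMr //.
  have: ((b - a) + (d - c)) / e < n%:R.
    apply: archi_boundP; apply: divr_ge0; last exact: ltW.
    by rewrite addr_ge0 // subr_ge0.
  move/lt_le_trans; apply; rewrite -natrX ler_nat; exact/ltnW/ltn_expl.
have [i1 i2 i3 i4] := inside n; have [w1 w2] := width n.
case: (svalP (s n)) => _ _; apply.
have /andP[x1 x2] := xP n; have /andP[y1 y2] := yP n.
apply: small; rewrite ?i1 ?i2 ?i3 ?i4 ?x1 ?x2 ?y1 ?y2 //.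
- by rewrite w1 ltr_pdivrMr ?exprn_gt0 //; lra.
- by rewrite w2 ltr_pdivrMr ?exprn_gt0 //; lra.
Qed.

End Bisection.

(** * Goursat's lemma for rectangles *)

Section Goursat.
Variable R : realType.
Local Notation K := (Rcomplex R).
Local Notation i := ('i%C : K).
Implicit Types (a b c d x y : R) (U : R -> R -> K).

Definition rect_int U a b c d : K :=
  cint a b (U^~ c) - cint a b (U^~ d) + i * (cint c d (U b) - cint c d (U a)).

Lemma mod_i : cmod i = 1.
Proof. by rewrite modE /= expr0n /= add0r expr1n sqrtr1. Qed.

(** The complex derivative of U, seen as a function of x + i y: the increment
    (x' - x, y' - y) is multiplied by D as a complex number. *)
Definition plane_diff U x y := exists D : K, forall e, 0 < e ->
  exists2 r : R, 0 < r & forall x' y', `|x' - x| < r -> `|y' - y| < r ->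
    cmod (U x' y' - U x y - D * (Complex (x' - x) (y' - y)))
    <= e * (`|x' - x| + `|y' - y|).

Variables (U : R -> R -> K) (a0 b0 c0 d0 : R).
Hypothesis cU1 : forall x y, a0 <= x <= b0 -> c0 <= y <= d0 ->
  ptcont (U^~ y) x.
Hypothesis cU2 : forall x y, a0 <= x <= b0 -> c0 <= y <= d0 ->
  ptcont (U x) y.

Lemma rect_int_quarter a b c d m n : a0 <= a -> a <= m <= b -> b <= b0 ->
  c0 <= c -> c <= n <= d -> d <= d0 ->
  rect_int U a b c d = rect_int U a m c n + rect_int U m b c n +
                       (rect_int U a m n d + rect_int U m b n d).
Proof.
move=> a0a amb bb0 c0c cnd dd0; have /andP[? ?] := amb; have /andP[? ?] := cnd.
have hx y : c0 <= y <= d0 ->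
    cint a b (U^~ y) = cint a m (U^~ y) + cint m b (U^~ y).
  by move=> y0; apply: cint_split => // x x0; apply: cU1 => //; lra.
have hy x : a0 <= x <= b0 ->
    cint c d (U x) = cint c n (U x) + cint n d (U x).
  by move=> x0; apply: cint_split => // y y0; apply: cU2 => //; lra.
by rewrite /rect_int !hx ?hy; [ring|lra..].
Qed.

(** The boundary integral of an affine function of x + i y vanishes, so only
    the error term E of the differential contributes: it is small compared to
    the diameter, and so is the perimeter. *)
Lemma rect_int_local x y e : a0 <= x <= b0 -> c0 <= y <= d0 ->
  plane_diff U x y -> 0 < e ->
  exists2 r : R, 0 < r & forall a b c d,
    a0 <= a <= x -> x <= b <= b0 -> c0 <= c <= y -> y <= d <= d0 ->
    b - a < r -> d - c < r ->
    cmod (rect_int U a b c d) <= e * ((b - a) + (d - c)) ^+ 2.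
Proof.
move=> x0 y0 [D hD] e0; have e20 : 0 < e / 2 by lra.
have [r r0 hr] := hD _ e20; exists r => // a b c d ha hb hc hd bar dcr.
pose E x' y' := U x' y' - U x y - D * (Complex (x' - x) (y' - y)).
have hE x' y' : a <= x' <= b -> c <= y' <= d ->
    cmod (E x' y') <= e / 2 * ((b - a) + (d - c)).
  move=> x'0 y'0; have hx : `|x' - x| <= b - a by rewrite ler_norml; lra.
  have hy : `|y' - y| <= d - c by rewrite ler_norml; lra.
  apply: le_trans (hr _ _ _ _) _; [lra|lra|].
  by rewrite ler_wpM2l ?lerD //; lra.
have key1 : cint a b (U^~ c) - cint a b (U^~ d) =
    cint a b (fun x' => E x' c - E x' d) + D * i * (c - d)%:C%C * (b - a)%:C%C.
  rewrite -cintB; try by move=> z hz; apply: cU1; lra.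
  have hcst : icont a b (fun=> D * i * (c - d)%:C%C : K).
    by move=> z _; exact: ptcont_cst.
  rewrite -(cint_cst (D * i * (c - d)%:C%C)); last lra.
  rewrite -cintD //; last first.
    move=> z hz; apply: (@eq_ptcont _ _ _
      (fun x' => U x' c - U x' d - D * i * (c - d)%:C%C) _ _ 1) => //.
      move=> w _; rewrite /E.
      have -> : Complex (w - x) (c - y) =
                Complex (w - x) (d - y) + i * (c - d)%:C%C :> K.
        by cplx_ring.
      by ring.
    by apply: ptcontB; [apply: ptcontB; apply: cU1; lra|exact: ptcont_cst].
  apply: eq_cint => w _; rewrite /E.
  have -> : Complex (w - x) (c - y) =
            Complex (w - x) (d - y) + i * (c - d)%:C%C :> K.
    by cplx_ring.
  by ring.
have key2 : cint c d (U b) - cint c d (U a) =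
    cint c d (fun y' => E b y' - E a y') + D * (b - a)%:C%C * (d - c)%:C%C.
  rewrite -cintB; try by move=> z hz; apply: cU2; lra.
  rewrite -(cint_cst (D * (b - a)%:C%C)); last lra.
  have cxE w : Complex (b - x) (w - y) =
               Complex (a - x) (w - y) + (b - a)%:C%C :> K.
    by cplx_ring.
  rewrite -cintD //; last first.
  - by move=> z _; exact: ptcont_cst.
  - move=> z hz; apply: (@eq_ptcont _ _ _
      (fun y' => U b y' - U a y' - D * (b - a)%:C%C) _ _ 1) => //.
      by move=> w _; rewrite /E cxE; ring.
    by apply: ptcontB; [apply: ptcontB; apply: cU2; lra|exact: ptcont_cst].
  by apply: eq_cint => w _; rewrite /E cxE; ring.
have -> : rect_int U a b c d = cint a b (fun x' => E x' c - E x' d) +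
    i * cint c d (fun y' => E b y' - E a y').
  rewrite /rect_int key1 key2.
  have -> : (c - d)%:C%C = - (d - c)%:C%C :> K by rewrite -rmorphN opprB.
  by ring.
have cE1 y' : c <= y' <= d -> icont a b (E^~ y').
  move=> hy' z hz; apply: ptcontB.
    by apply: ptcontB; [apply: cU1; lra|exact: ptcont_cst].
  apply: ptcontM; first exact: ptcont_cst.
  apply: (@ptcont_lip _ _ _ _ _ 1) => w; rewrite mul1r.
  have -> : Complex (w - x) (y' - y) - Complex (z - x) (y' - y) =
            (w - z)%:C%C :> K.
    by cplx_ring.
  by rewrite modR.
have cE2 x' : a <= x' <= b -> icont c d (E x').
  move=> hx' z hz; apply: ptcontB.
    by apply: ptcontB; [apply: cU2; lra|exact: ptcont_cst].
  apply: ptcontM; first exact: ptcont_cst.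
  apply: (@ptcont_lip _ _ _ _ _ 1) => w; rewrite mul1r.
  have -> : Complex (x' - x) (w - y) - Complex (x' - x) (z - y) =
            i * (w - z)%:C%C :> K.
    by cplx_ring.
  by rewrite modM mod_i mul1r modR.
apply: le_trans (ler_normD _ _) _; rewrite modM mod_i mul1r.
have b1 : cmod (cint a b (fun x' => E x' c - E x' d)) <=
    e * ((b - a) + (d - c)) * (b - a).
  apply: cint_le; first lra.
    by move=> z hz; apply: ptcontB; apply: cE1 => //; lra.
  move=> z hz; apply: le_trans (ler_normB _ _) _.
  apply: le_trans (lerD (hE z c _ _) (hE z d _ _)) _; lra.
have b2 : cmod (cint c d (fun y' => E b y' - E a y')) <=
    e * ((b - a) + (d - c)) * (d - c).
  apply: cint_le; first lra.
    by move=> z hz; apply: ptcontB; apply: cE2 => //; lra.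
  move=> z hz; apply: le_trans (ler_normB _ _) _.
  apply: le_trans (lerD (hE b z _ _) (hE a z _ _)) _; lra.
by apply: le_trans (lerD b1 b2) _; rewrite -mulrDr -mulrA -expr2.
Qed.

(** The bound e * diam^2 is local by rect_int_local, and it passes from the
    four quarters of a rectangle to the rectangle since their diameters are
    halved. *)
Lemma goursat : a0 <= b0 -> c0 <= d0 ->
  (forall x y, a0 <= x <= b0 -> c0 <= y <= d0 -> plane_diff U x y) ->
  rect_int U a0 b0 c0 d0 = 0.
Proof.
move=> ab cd hU; apply/eqP; rewrite -normr_eq0 eq_le normr_ge0 andbT.
set S := ((b0 - a0) + (d0 - c0)) ^+ 2 + 1.
have S0 : 0 < S by rewrite ltr_wpDl // sqr_ge0.
apply/ler_addgt0Pr => e e0; rewrite add0r.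
pose good a b c d := a0 <= a -> b <= b0 -> c0 <= c -> d <= d0 ->
  cmod (rect_int U a b c d) <= e / S * ((b - a) + (d - c)) ^+ 2.
suff /(_ (lexx _) (lexx _) (lexx _) (lexx _)) h : good a0 b0 c0 d0.
  apply: le_trans h _; rewrite mulrAC ler_pdivrMr // ler_pM2l //.
  by rewrite /S lerDl.
apply: rect_bisection => //.
  move=> a b c d ab1 cd1 m n g1 g2 g3 g4 ha hb hc hd.
  have hm : a <= m <= b by rewrite /m; lra.
  have hn : c <= n <= d by rewrite /n; lra.
  rewrite (@rect_int_quarter a b c d m n) //.
  have tri (u v w z : K) :
      cmod (u + v + (w + z)) <= (cmod u + cmod v) + (cmod w + cmod z).
    by apply: le_trans (ler_normD _ _) _; apply: lerD; exact: ler_normD.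
  apply: le_trans (tri _ _ _ _) _.
  have {}g1 := g1 ha ltac:(lra) hc ltac:(lra).
  have {}g2 := g2 ltac:(lra) hb hc ltac:(lra).
  have {}g3 := g3 ha ltac:(lra) ltac:(lra) hd.
  have {}g4 := g4 ltac:(lra) hb ltac:(lra) hd.
  apply: le_trans (lerD (lerD g1 g2) (lerD g3 g4)) _.
  by rewrite le_eqVlt; apply/orP; left; apply/eqP; rewrite /m /n; field; lra.
move=> x y hx hy; have eS : 0 < e / S by exact: divr_gt0.
have [r r0 hr] := rect_int_local hx hy (hU x y hx hy) eS.
by exists r => // a b c d ha hb hc hd l1 l2 _ _ _ _; exact: hr.
Qed.

End Goursat.

(** * Complex differentiability *)

Section Complex_derivative.
Variable R : realType.
Local Notation K := (Rcomplex R).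
Local Notation i := ('i%C : K).
Implicit Types (z w : K) (g H : K -> K).

Definition cdiff g z := exists D : K, forall e : R, 0 < e ->
  exists2 r : R, 0 < r & forall w, cmod (w - z) < r ->
    cmod (g w - g z - D * (w - z)) <= e * cmod (w - z).

Lemma cdiff_ptcont g z : cdiff g z -> ptcont g z.
Proof.
move=> [D /(_ 1 ltr01)[r r0 hr]] e e0.
have D1 : 0 < 1 + cmod D by rewrite ltr_wpDr.
exists (Num.min r (e / (1 + cmod D))); first by rewrite lt_min r0 divr_gt0.
move=> w; rewrite lt_min => /andP[/hr wr]; rewrite ltr_pdivlMr // => we.
rewrite -(subrK (D * (w - z)) (g w - g z)).
apply: le_lt_trans (ler_normD _ _) _; rewrite modM.
by move: we; lra.
Qed.

Lemma cdiff_comp_plane (V : R -> R -> K) g x y :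
  plane_diff V x y -> cdiff g (V x y) ->
  plane_diff (fun x y => g (V x y)) x y.
Proof.
move=> [D1 h1] [D2 h2]; exists (D2 * D1) => e e0.
have p1 : 0 < 1 + cmod D1 by rewrite ltr_wpDr.
have p2 : 0 < 1 + cmod D2 by rewrite ltr_wpDr.
have e1 : 0 < Num.min 1 (e / 2 / (1 + cmod D2)).
  by rewrite lt_min ltr01 !divr_gt0.
have e2 : 0 < e / 2 / (1 + cmod D1) by rewrite !divr_gt0.
have [r1 r10 hr1] := h1 _ e1; have [r2 r20 hr2] := h2 _ e2.
exists (Num.min r1 (r2 / (1 + cmod D1) / 2)).
  by rewrite lt_min r10 !divr_gt0.
move=> x' y'; rewrite !lt_min => /andP[x1 x2] /andP[y1 y2].
have := hr1 _ _ x1 y1; set N := `|x' - x| + `|y' - y|.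
set h : K := Complex (x' - x) (y' - y); set v := V x' y' - V x y => hv.
have N0 : 0 <= N by rewrite addr_ge0.
have hN : cmod h <= N by exact: mod_le_ReIm.
have {hv} [hv1 hv2] : cmod (v - D1 * h) <= N /\
    cmod (v - D1 * h) * (1 + cmod D2) <= e / 2 * N.
  split; apply: le_trans hv _ || apply: le_trans (ler_wpM2r (ltW p2) hv) _.
    by rewrite -[leRHS]mul1r ler_wpM2r // ge_min lexx.
  rewrite mulrAC ler_wpM2r // -ler_pdivlMr //.
  by rewrite ge_min lexx orbT.
have vN : cmod v <= (1 + cmod D1) * N.
  rewrite -(subrK (D1 * h) v); apply: le_trans (ler_normD _ _) _.
  rewrite mulrDl mul1r lerD // modM ler_wpM2l //.
have vr : cmod v < r2.
  apply: le_lt_trans vN _; rewrite mulrC -ltr_pdivlMr //.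
  by move: x2 y2; rewrite /N; lra.
have := hr2 _ vr; rewrite -/v => hg.
have -> : g (V x' y') - g (V x y) - D2 * D1 * h =
  g (V x' y') - g (V x y) - D2 * v + D2 * (v - D1 * h) by ring.
apply: le_trans (ler_normD _ _) _; rewrite modM.
have {}hg : cmod (g (V x' y') - g (V x y) - D2 * v) <= e / 2 * N.
  apply: le_trans hg _; rewrite mulrAC ler_pdivrMr // -[leRHS]mulrA.
  by rewrite ler_pM2l ?divr_gt0 // mulrC.
apply: le_trans (lerD hg (_ : _ <= e / 2 * N)) _; last lra.
by apply: le_trans hv2; rewrite mulrC ler_wpM2l // lerDr.
Qed.

Lemma cdiff_ext g H z (r : R) : 0 < r ->
  (forall w, cmod (w - z) < r -> g w = H w) -> cdiff g z -> cdiff H z.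
Proof.
move=> r0 gH [D hD]; exists D => e /hD[s s0 hs].
exists (Num.min r s); first by rewrite lt_min r0.
move=> w; rewrite lt_min => /andP[wr ws].
by rewrite -!gH ?subrr ?normr0 //; exact: hs.
Qed.

Lemma cdiff_affine a b z : cdiff (fun w => a * w + b) z.
Proof.
exists a => e e0; exists 1 => // w _.
rewrite (_ : _ - _ - _ = 0); last by ring.
by rewrite normr0 mulr_ge0 // ltW.
Qed.

Lemma cdiffV_affine (a b z : K) : a * z + b != 0 ->
  cdiff (fun w => (a * w + b)^-1) z.
Proof.
move=> z0; exists (- a * (a * z + b)^-1 ^+ 2) => e e0.
have A : 0 < 1 + cmod a by rewrite ltr_wpDr.
have Z : 0 < cmod (a * z + b) by rewrite normr_gt0.
have c0 := cdiff_ptcont (cdiff_affine a b z).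
have : 0 < e * cmod (a * z + b) / (1 + cmod a) by rewrite divr_gt0 ?mulr_gt0.
move=> /(ptcontV c0 z0)[r r0 hr]; have [s s0 hs] := c0 _ Z.
exists (Num.min r s); first by rewrite lt_min r0.
move=> w; rewrite lt_min => /andP[/hr {}hr /hs ws].
have w0 : a * w + b != 0.
  by apply: contraTneq ws => ->; rewrite sub0r normrN ltxx.
have -> : (a * w + b)^-1 - (a * z + b)^-1 - - a * (a * z + b)^-1 ^+ 2 * (w - z)
    = - a * ((a * w + b)^-1 - (a * z + b)^-1) * (a * z + b)^-1 * (w - z).
  by field; rewrite w0 z0.
rewrite modM ler_wpM2r // 2!modM modV normrN ler_pdivrMr // mulrC.
apply: le_trans (ler_wpM2r (normr_ge0 _) (ltW hr)) _.
rewrite mulrAC ler_pdivrMr // ler_wpM2l ?lerDr //.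
by rewrite mulr_ge0 // ltW.
Qed.

Lemma cdiffM g H z : cdiff g z -> cdiff H z -> cdiff (fun w => g w * H w) z.
Proof.
move=> dg dH; have cg := cdiff_ptcont dg.
case: dg dH => [D hD] [E hE]; exists (D * H z + g z * E) => e e0.
pose B := 1 + cmod (H z) + cmod (g z) + 1 + cmod E.
have B0 : 0 < B by rewrite !ltr_wpDr.
have e1 : 0 < Num.min 1 (e / (3 * B)).
  by rewrite lt_min ltr01 divr_gt0 // mulr_gt0.
have [r r0 hr] := hD _ e1; have [s s0 hs] := hE _ e1.
have [u u0 hu] := cg _ e1.
exists (Num.min r (Num.min s u)); first by rewrite !lt_min r0 s0.
move=> w; rewrite !lt_min => /and3P[/hr {}hr /hs {}hs /hu {}hu].
have -> : g w * H w - g z * H z - (D * H z + g z * E) * (w - z) =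
  (g w - g z - D * (w - z)) * H z + g w * (H w - H z - E * (w - z)) +
  (g w - g z) * (E * (w - z)) by ring.
apply: le_trans (ler_normD _ _) _.
apply: le_trans (lerD (ler_normD _ _) (lexx _)) _; rewrite !modM.
set m := Num.min _ _ in hr hs hu; have m1 : m <= 1 by rewrite ge_min lexx.
have mB : m * B <= e / 3.
  have : m <= e / (3 * B) by rewrite ge_min lexx orbT.
  by rewrite invfM mulrA ler_pdivlMr.
have gw : cmod (g w) <= cmod (g z) + 1.
  rewrite -(subrK (g z) (g w)); apply: le_trans (ler_normD _ _) _; lra.
set d := cmod (w - z) in hr hs *; have d0 : 0 <= d := normr_ge0 _.
have [Hz0 gz0 E0] := And3 (normr_ge0 (H z)) (normr_ge0 (g z)) (normr_ge0 E).
have HB : cmod (H z) <= B by rewrite /B; lra.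
have gB : cmod (g z) + 1 <= B by rewrite /B; lra.
have EB : cmod E <= B by rewrite /B; lra.
have m0 : 0 <= m := ltW e1.
have t1 : cmod (g w - g z - D * (w - z)) * cmod (H z) <= e / 3 * d.
  apply: le_trans (ler_pM _ _ hr HB) _ => //.
  by rewrite mulrAC ler_wpM2r.
have t2 : cmod (g w) * cmod (H w - H z - E * (w - z)) <= e / 3 * d.
  apply: le_trans (ler_pM _ _ (le_trans gw gB) hs) _ => //.
  by rewrite mulrCA mulrA ler_wpM2r // mulrC.
have t3 : cmod (g w - g z) * (cmod E * d) <= e / 3 * d.
  rewrite mulrA ler_wpM2r //; apply: le_trans mB.
  by apply: ler_pM => //; exact: ltW.
lra.
Qed.

End Complex_derivative.

(** * Polar coordinates *)

Section Polar_coordinates.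
Variable R : realType.
Local Notation K := (Rcomplex R).
Local Notation i := ('i%C : K).
Implicit Types (z w : K) (g H : K -> K) (t x y : R).

Definition polar t y : K := Complex (t * cos y) (t * sin y).

Lemma mod_polar t y : cmod (polar t y) = `|t|.
Proof.
by rewrite modE /= !exprMn -mulrDr cos2Dsin2 mulr1 sqrtr_sqr.
Qed.

Lemma polarM t t' y y' : polar t y * polar t' y' = polar (t * t') (y + y').
Proof.
by rewrite /polar cplxM cosD sinD; congr Complex; ring.
Qed.

Lemma polar_conj t y : ((polar t y)^*)%C * polar t y = (t ^+ 2)%:C%C.
Proof.
by rewrite mulrC -sqr_mod mod_polar real_normK // num_real.
Qed.

Lemma polar2pi t : polar t (pi *+ 2) = polar t 0.
Proof. by rewrite /polar cos2pi sin2pi cos0 sin0. Qed.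

Lemma polar0 y : polar 0 y = 0.
Proof. by rewrite /polar !mul0r. Qed.

Lemma polarB t t' y : cmod (polar t y - polar t' y) = `|t - t'|.
Proof.
rewrite -(mod_polar _ y); congr Num.norm.
by rewrite /polar cplxN cplxD; congr Complex; ring.
Qed.

Lemma ptcont_cplx (u v : R -> R) x : ptcont u x -> ptcont v x ->
  ptcont (fun x => Complex (u x) (v x) : K) x.
Proof.
move=> cu cv e e0; have e20 : 0 < e / 2 by lra.
have [r r0 hr] := cu _ e20; have [s s0 hs] := cv _ e20.
exists (Num.min r s); first by rewrite lt_min r0.
move=> y; rewrite lt_min => /andP[/hr {}hr /hs {}hs].
apply: le_lt_trans (mod_le_ReIm _) _; rewrite cplxN cplxD /=; lra.
Qed.

Lemma ptcont_polar_angle t y : ptcont (polar t) y.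
Proof.
apply: ptcont_cplx; apply/ptcont_continuous; apply: cvgM;
  by [exact: cvg_cst|exact: continuous_cos|exact: continuous_sin].
Qed.

Lemma ptcont_polar_radius t y : ptcont (polar^~ y) t.
Proof.
by apply: (@ptcont_lip _ _ _ _ _ 1) => t'; rewrite mul1r polarB.
Qed.

(** The differential of a real function as an estimate on the increment, in the
    same form as cdiff. *)
Lemma is_derive_dist (u : R -> R) x d : is_derive x 1 u d ->
  forall e, 0 < e -> exists2 r : R, 0 < r & forall y, `|y - x| < r ->
    `|u y - u x - d * (y - x)| <= e * `|y - x|.
Proof.
move=> [du dv] e e0.
have : h^-1 *: ((u \o shift x) (h *: 1) - u x) @[h --> 0^'] --> d.
  by rewrite -dv; exact: du.
move=> /cvgrPdist_le /(_ e e0).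
rewrite /dnbhs /within /= => /nbhs_ballP[r /= r0 hr].
exists r => // y yx.
have [->|yNx] := eqVneq y x; first by rewrite !subrr mulr0 subr0 normr0 mulr0.
have yx0 : y - x != 0 by rewrite subr_eq0.
have := hr (y - x); rewrite /ball /= sub0r normrN => /(_ yx yx0).
rewrite [_ *: 1]mulr1 subrK => h.
rewrite -[X in X <= _]normrN -[leLHS]mul1r.
rewrite -(@ler_pM2l _ `|(y - x)^-1|); last by rewrite normr_gt0 invr_eq0.
rewrite mulrCA -normrM mul1r mulrCA -normrM mulVf // normr1 mulr1.
apply: le_trans h; rewrite le_eqVlt; apply/orP; left; apply/eqP.
congr Num.norm; rewrite -[_ *: _]/(_ * _); field.
by [].
Qed.

(** exp is its own complex derivative: by the addition formulas it is enough to
    expand at 0, from the real derivatives of exp, cos and sin. *)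
Lemma expi_plane_diff x y : plane_diff (fun x y => polar (expR x) y) x y.
Proof.
exists (polar (expR x) y) => e e0.
set z := polar (expR x) y; have z0 : 0 < cmod z.
  by rewrite mod_polar normr_gt0 gt_eqF // expR_gt0.
pose e1 := Num.min 1 (e / cmod z / 6).
have e10 : 0 < e1 by rewrite lt_min ltr01 !divr_gt0.
have [r1 r10 hexp] := is_derive_dist (is_derive_expR (0 : R)) e10.
have [r2 r20 hcos] := is_derive_dist (is_derive_cos (0 : R)) e10.
have [r3 r30 hsin] := is_derive_dist (is_derive_sin (0 : R)) e10.
exists (Num.min (Num.min r1 (e1 / 2)) (Num.min r2 r3)).
  by rewrite !lt_min r10 r20 r30 divr_gt0.
move=> x' y'; rewrite !lt_min.
move=> /andP[/andP[u1 u2] _] /andP[_ /andP[v2 v3]].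
set h := x' - x; set k := y' - y.
have -> : x' = x + h by rewrite /h addrC subrK.
have -> : y' = y + k by rewrite /k addrC subrK.
rewrite expRD -polarM -/z.
have -> : z * polar (expR h) k - z - z * Complex h k =
  z * (polar (expR h) k - 1 - Complex h k) by ring.
rewrite modM -ler_pdivlMl //.
have {hexp} := hexp h; rewrite !subr0 expR0 mul1r => /(_ u1) hexp.
have {hcos} := hcos k.
rewrite !subr0 cos0 sin0 oppr0 mul0r subr0 => /(_ v2) hcos.
have {hsin} := hsin k; rewrite !subr0 cos0 sin0 mul1r subr0 => /(_ v3) hsin.
have e1le : e1 <= 1 by rewrite ge_min lexx.
have e1le' : e1 <= e / cmod z / 6 by rewrite ge_min lexx orbT.
rewrite -/h in u2 u1; rewrite -/k in v2 v3.
have hexp' : `|expR h - 1| <= e1.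
  rewrite -(subrK h (expR h - 1)); apply: le_trans (ler_normD _ _) _.
  by have := normr_ge0 h; nra.
have hexp2 : `|expR h| <= 2.
  rewrite -(subrK 1 (expR h)); apply: le_trans (ler_normD _ _) _.
  by rewrite normr1; lra.
apply: le_trans (mod_le_ReIm _) _.
have -> : polar (expR h) k - 1 - Complex h k =
  Complex (expR h * (cos k - 1) + (expR h - 1 - h))
          (expR h * (sin k - k) + (expR h - 1) * k) :> K.
  rewrite -[1 in LHS]/(Complex 1 0).
  by rewrite /polar !(cplxN, cplxD); congr Complex; ring.
rewrite /=.
have hk := normr_ge0 k; have hh := normr_ge0 h.
have a1 : `|expR h * (cos k - 1)| <= 2 * (e1 * `|k|).
  by rewrite normrM ler_pM.
have a2 : `|expR h * (sin k - k)| <= 2 * (e1 * `|k|).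
  by rewrite normrM ler_pM.
have a3 : `|(expR h - 1) * k| <= e1 * `|k| by rewrite normrM ler_wpM2r.
apply: le_trans (lerD (ler_normD _ _) (ler_normD _ _)) _.
apply: le_trans (_ : e1 * (`|h| + 5 * `|k|) <= _); first lra.
have -> : (cmod z)^-1 * (e * (`|h| + `|k|)) =
    e / cmod z / 6 * (6 * (`|h| + `|k|)).
  by field; rewrite gt_eqF.
by apply: ler_pM => //; lra.
Qed.

End Polar_coordinates.

(** * Means over circles *)

Section Circle_means.
Variable R : realType.
Local Notation K := (Rcomplex R).
Local Notation i := ('i%C : K).
Local Notation T := (pi *+ 2 : R).
Implicit Types (z w : K) (g H : K -> K) (t x y : R).

Lemma T_gt0 : 0 < T. Proof. by rewrite pmulrn_lgt0 // pi_gt0. Qed.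

(** This is 2 pi times the mean of H over the circle of radius t, with respect
    to the angle. *)
Definition circle_int H t : K := cint 0 T (fun y => H (polar t y)).

Lemma icont_circle H t a b : (forall z, cmod z = `|t| -> ptcont H z) ->
  icont a b (fun y => H (polar t y)).
Proof.
move=> cH y _; apply: ptcont_comp; first exact: ptcont_polar_angle.
by apply: cH; rewrite mod_polar.
Qed.

(** In the coordinates x + i y = log z the annulus is a rectangle of height
    2 pi; its horizontal sides cancel by periodicity, and Goursat's lemma
    equates the vertical ones. *)
Lemma circle_int_annulus H t1 t2 : 0 < t1 <= t2 ->
  (forall z, t1 <= cmod z <= t2 -> cdiff H z) ->
  circle_int H t1 = circle_int H t2.
Proof.
move=> /andP[t10 t12] dH; have t20 := lt_le_trans t10 t12.
pose U x y := H (polar (expR x) y).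
have on x y : ln t1 <= x <= ln t2 -> cdiff H (polar (expR x) y).
  move=> /andP[x1 x2]; apply: dH.
  rewrite mod_polar gtr0_norm ?expR_gt0 //.
  move: x1 x2; rewrite -!(ler_expR _ (ln _)) -(ler_expR (ln _)) !lnK ?posrE //.
  by move=> -> ->.
have : rect_int U (ln t1) (ln t2) 0 T = 0.
  apply: goursat.
  - move=> x y hx _.
    apply: (@ptcont_comp _ _ _ _ (fun x => polar (expR x) y) H).
      2: exact/cdiff_ptcont/on.
    apply: (@ptcont_comp _ _ _ _ expR (fun t => polar t y)).
      exact/ptcont_continuous/continuous_expR.
    exact: ptcont_polar_radius.
  - move=> x y hx _; apply: (@ptcont_comp _ _ _ _ (polar (expR x)) H).
      exact: ptcont_polar_angle.
    exact/cdiff_ptcont/on.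
  - by rewrite ler_ln ?posrE.
  - exact/ltW/T_gt0.
  - move=> x y hx _.
    apply: (@cdiff_comp_plane _ (fun x y => polar (expR x) y) H).
      exact: expi_plane_diff.
    exact: on.
rewrite /rect_int /U.
have -> : cint (ln t1) (ln t2) (fun x => H (polar (expR x) T)) =
          cint (ln t1) (ln t2) (fun x => H (polar (expR x) 0)).
  by apply: eq_cint => x _; rewrite polar2pi.
rewrite subrr add0r !lnK ?posrE // => /eqP; rewrite mulf_eq0.
have /negbTE -> /= : i != 0.
  by rewrite -(@normr_gt0 _ (Rcomplex R)) mod_i ltr01.
by rewrite subr_eq0 => /eqP h; exact: esym h.
Qed.

(** The circle is compact: a modulus of continuity valid on each half of an
    interval of angles is valid on the interval, so rect_bisection applies, with
    a degenerate first side. *)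
Lemma circle_unif_cont H t e : (forall z, cmod z = `|t| -> ptcont H z) ->
  0 < e -> exists2 r : R, 0 < r & forall y w, 0 <= y <= T ->
    cmod (w - polar t y) < r -> cmod (H w - H (polar t y)) <= e.
Proof.
move=> cH e0.
pose good (a b c d : R) := exists2 r : R, 0 < r & forall y w, c <= y <= d ->
    cmod (w - polar t y) < r -> cmod (H w - H (polar t y)) <= e.
suff: good 0 0 0 T by [].
apply: rect_bisection => //; first exact/ltW/T_gt0.
  move=> a b c d _ cd m n [r r0 hr] _ [s s0 hs] _.
  exists (Num.min r s); first by rewrite lt_min r0.
  move=> y w /andP[cy yd]; rewrite lt_min => /andP[wr ws].
  have [yn|/ltW ny] := leP y n; first by apply: hr; rewrite ?cy.
  by apply: hs; rewrite ?ny.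
move=> x y _ _; have e20 : 0 < e / 2 by lra.
have [r r0 hr] := cH (polar t y) (mod_polar _ _) _ e20.
have r20 : 0 < r / 2 by lra.
have [s s0 hs] := ptcont_polar_angle t y r20.
exists s => // a b c d _ _ /andP[_ cy] /andP[yd _] _ dc.
exists (r / 2) => // y' w /andP[cy' yd'] wr.
have {}hs : cmod (polar t y' - polar t y) < r / 2.
  by apply: hs; rewrite ltr_norml; lra.
have u1 : cmod (H w - H (polar t y)) < e / 2.
  apply: hr; rewrite -(subrKA (polar t y')).
  by apply: le_lt_trans (ler_normD _ _) _; lra.
have u2 : cmod (H (polar t y') - H (polar t y)) < e / 2.
  by apply: hr; lra.
rewrite -(subrKA (H (polar t y))); apply: le_trans (ler_normD _ _) _.
by rewrite [X in _ + X]distrC; lra.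
Qed.

Lemma circle_int_cont H t e : (forall z, cmod z = `|t| -> ptcont H z) ->
  0 < e -> exists2 r : R, 0 < r & forall t', `|t' - t| < r ->
    (forall z, cmod z = `|t'| -> ptcont H z) ->
    cmod (circle_int H t' - circle_int H t) <= e.
Proof.
move=> cH e0; have eT : 0 < e / T by rewrite divr_gt0 ?T_gt0.
have [r r0 hr] := circle_unif_cont cH eT.
exists r => // t' tr cH'; rewrite -cintB; try exact: icont_circle.
have -> : e = e / T * (T - 0) by rewrite subr0 divfK // gt_eqF ?T_gt0.
apply: cint_le; first exact/ltW/T_gt0.
  by move=> y hy; apply: ptcontB; apply: (icont_circle _ hy).
by move=> y hy; apply: hr => //; rewrite polarB.
Qed.

(** For use at a radius t where H need not be differentiable: the value of the
    mean is inherited from radii arbitrarily close to t. *)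
Lemma circle_int_lim H t v : (forall z, cmod z = `|t| -> ptcont H z) ->
  (forall r, 0 < r -> exists t', [/\ `|t' - t| < r,
    forall z, cmod z = `|t'| -> ptcont H z & circle_int H t' = v]) ->
  circle_int H t = v.
Proof.
move=> cH hv; apply/esym/eqP; rewrite -subr_eq0 -(@normr_eq0 _ (Rcomplex R)).
rewrite eq_le normr_ge0 andbT; apply/ler_addgt0Pr => e e0; rewrite add0r.
have [r r0 hr] := circle_int_cont cH e0.
have [t' [tr ct' <-]] := hv _ r0; exact: hr.
Qed.

(** The mean value property tolerates a point p where H is only continuous:
    circles of radius above and below |p| give two constants, which agree by
    continuity in the radius. *)
Lemma circle_mean H rho p t : cmod p < t < rho ->
  (forall z, cmod z < rho -> ptcont H z) ->
  (forall z, cmod z < rho -> z != 0 -> z != p -> cdiff H z) ->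
  circle_int H t = T%:C%C * H 0.
Proof.
move=> /andP[pt trho] cH dH.
have p0 : 0 <= cmod p := normr_ge0 _.
have cH' t' : 0 <= t' < rho -> forall z, cmod z = `|t'| -> ptcont H z.
  by move=> /andP[t0 t1] z hz; apply: cH; rewrite hz ger0_norm.
have flat t1 t2 : 0 < t1 <= t2 -> t2 < rho ->
    (cmod p < t1) || (t2 < cmod p) -> circle_int H t1 = circle_int H t2.
  move=> /andP[t10 t12] t2r pout; apply: circle_int_annulus; rewrite ?t10 //.
  move=> z /andP[z1 z2]; apply: dH; first lra.
    by rewrite -(@normr_gt0 _ (Rcomplex R)); lra.
  by apply: contraTneq pout => <-; lra.
have at0 : circle_int H 0 = T%:C%C * H 0.
  have -> : circle_int H 0 = cint 0 T (fun=> H 0).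
    by apply: eq_cint => y _; rewrite polar0.
  by rewrite cint_cst ?subr0 1?mulrC // ltW ?T_gt0.
have atp : circle_int H (cmod p) = circle_int H t.
  apply: circle_int_lim => [|r r0]; first by apply: cH'; lra.
  pose t' := Num.min t (cmod p + r / 2).
  have ht' : [/\ cmod p < t', t' <= t & t' <= cmod p + r / 2].
    by rewrite /t' lt_min !ge_min lexx lexx orbT; split => //; lra.
  case: ht' => h1 h2 h3; exists t'; split.
  - by rewrite ltr_norml; lra.
  - by apply: cH'; lra.
  - by apply: flat; rewrite ?h1 ?h2 //; lra.
rewrite -atp; have [->|pN0] := eqVneq (cmod p) 0; first exact: at0.
have {}p0 : 0 < cmod p by rewrite lt_neqAle eq_sym pN0.
have below t1 : 0 < t1 < cmod p -> circle_int H t1 = circle_int H 0.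
  move=> ht1; apply/esym.
  apply: circle_int_lim => [|r r0]; first by apply: cH'; lra.
  pose t' := Num.min t1 (r / 2).
  have ht' : [/\ 0 < t', t' <= t1 & t' <= r / 2].
    by rewrite /t' lt_min !ge_min lexx lexx orbT; split => //; lra.
  case: ht' => h1 h2 h3; exists t'; split.
  - by rewrite ltr_norml; lra.
  - by apply: cH'; lra.
  - by apply: flat; rewrite ?h1 ?h2 //; [lra|apply/orP; right; lra].
rewrite -at0; apply: circle_int_lim => [|r r0]; first by apply: cH'; lra.
pose t' := Num.max (cmod p / 2) (cmod p - r / 2).
have ht' : [/\ cmod p / 2 <= t', cmod p - r / 2 <= t' & t' < cmod p].
  by rewrite /t' gt_max !le_max lexx lexx orbT; split => //; lra.
case: ht' => h1 h2 h3; exists t'; split.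
- by rewrite ltr_norml; lra.
- by apply: cH'; lra.
- by apply: below; lra.
Qed.

End Circle_means.

(** * Cauchy's formula on a circle *)

Section Cauchy_formula.
Variable R : realType.
Local Notation K := (Rcomplex R).
Local Notation T := (pi *+ 2 : R).
Implicit Types (p z w u : K) (g H : K -> K).

Definition cauchy_kernel (u z : K) : K := (1 - z / u)^-1.

Lemma cmod_lt_neq z w : cmod z < cmod w -> w - z != 0.
Proof. by apply: contraTneq => /subr0_eq ->; rewrite ltxx. Qed.

Lemma kernelE u z : cmod z < cmod u -> cauchy_kernel u z = u / (u - z).
Proof.
move=> zu; have uz := cmod_lt_neq zu.
have u0 : u != 0 by rewrite -(@normr_gt0 _ (Rcomplex R)) (le_lt_trans _ zu).
by rewrite /cauchy_kernel; field; rewrite u0 uz.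
Qed.

Lemma ptcont_kernel z u : cmod z < cmod u -> ptcont (cauchy_kernel^~ z) u.
Proof.
move=> zu; have uz := cmod_lt_neq zu.
have u0 : u != 0 by rewrite -(@normr_gt0 _ (Rcomplex R)) (le_lt_trans _ zu).
have c : ptcont (fun u : K => 1 - z / u) u.
  apply: ptcontB; first exact: ptcont_cst.
  apply: ptcontM; first exact: ptcont_cst.
  by apply: ptcontV => // e e0; exists e.
apply: ptcontV => //; apply: contra uz => /eqP h.
by rewrite -[u - z]mulr1 -(divff u0) mulrCA mulrBl divff // h mulr0.
Qed.

(** Inversion in the circle: on |u| = s the conjugate of 1 / (1 - p / u) is
    1 / (1 - p^* w) with |w| = 1 / s, which is holomorphic in w. *)
Lemma kernel_mean p s : cmod p < s ->
  cint 0 T (fun y => cauchy_kernel (polar s y) p) = T%:C%C.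
Proof.
move=> ps; have s0 : 0 < s by apply: le_lt_trans ps.
have p0 : 0 <= cmod p := normr_ge0 _.
pose H w : K := (- (p^*)%C * w + 1)^-1.
pose rho := 2 / (s + cmod p).
have H0 z : cmod z < rho -> - (p^*)%C * z + 1 != 0 :> K.
  move=> hz; rewrite addrC mulNr; apply: cmod_lt_neq.
  rewrite mod1 modM mod_conj.
  have : cmod z * (s + cmod p) < 2 by rewrite -ltr_pdivlMr //; lra.
  by have := normr_ge0 (z : Rcomplex R); nra.
have dH z : cmod z < rho -> cdiff H z by move=> /H0; exact: cdiffV_affine.
have HJ w : ((H w)^*)%C = (1 - p * (w^*)%C)^-1 :> K.
  rewrite /H conjc_inv rmorphD rmorphM rmorphN rmorph1 /= conjcK.
  by rewrite mulNr addrC.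
have hs : cmod (0 : K) < s^-1 < rho.
  rewrite normr0 invr_gt0 s0 /rho ltr_pdivlMr; last lra.
  by rewrite mulrC ltr_pdivrMr //; lra.
have -> : cint 0 T (fun y => cauchy_kernel (polar s y) p) =
          cint 0 T (fun y => ((H (polar s^-1 y))^*)%C).
  apply: eq_cint => y _.
  have e : ((polar s^-1 y)^*)%C = (polar s y)^-1 :> K.
    have u0 : polar s y != 0.
      by rewrite -(@normr_gt0 _ (Rcomplex R)) mod_polar normr_gt0 gt_eqF.
    apply: (mulIf u0); rewrite mulVf //.
    have -> : polar s y = (s ^+ 2)%:C%C * polar s^-1 y :> K.
      rewrite /polar /real_complex_def cplxM; congr Complex; field; lra.
    rewrite mulrCA polar_conj -rmorphM /= -exprMn divff ?expr1n //.
    by rewrite gt_eqF.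
  by rewrite HJ e.
rewrite cint_conj; last first.
  apply: icont_circle => z hz; apply/cdiff_ptcont/dH.
  by rewrite hz gtr0_norm ?invr_gt0 //; case/andP: hs.
have -> : cint 0 T (fun y => H (polar s^-1 y)) = T%:C%C * H 0.
  apply: (circle_mean hs) => z hz; first exact/cdiff_ptcont/dH.
  by move=> _ _; exact: dH.
by rewrite /H mulr0 add0r invr1 mulr1 conjc_real.
Qed.

(** Removing the singularity of z (g(z) - g(p)) / (z - p) at p leaves a function
    that vanishes at 0, is continuous, and is differentiable away from p. *)
Theorem cauchy_circle g p s rho : cmod p < s < rho ->
  (forall z, cmod z < rho -> cdiff g z) ->
  cint 0 T (fun y => g (polar s y) * cauchy_kernel (polar s y) p) =
  T%:C%C * g p.
Proof.
move=> hps dg; have /andP[ps srho] := hps.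
have s0 : 0 < s by apply: le_lt_trans ps.
have prho := lt_trans ps srho.
have [D hD] := dg _ prho.
pose Q z : K := if z == p then D else (g z - g p) / (z - p).
pose H z := z * Q z.
have dQ z : cmod z < rho -> z != p -> cdiff Q z.
  move=> hz zp; have zp0 : 0 < cmod (z - p) by rewrite normr_gt0 subr_eq0.
  apply: (@cdiff_ext _ (fun w => (1 * g w + - g p) * (1 * w + - p)^-1)
    _ _ _ zp0).
    move=> w wz; rewrite /Q; case: eqVneq => [wp|_]; last by rewrite !mul1r.
    by move: wz; rewrite wp distrC ltxx.
  apply: cdiffM; last by apply: cdiffV_affine; rewrite mul1r subr_eq0.
  have [E hE] := dg _ hz; exists E => e /hE[r r0 hr].
  exists r => // w /hr; rewrite !mul1r.
  by have -> : g w - g p - (g z - g p) = g w - g z by ring.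
have cQ z : cmod z < rho -> ptcont Q z.
  move=> hz; have [->|zp] := eqVneq z p; last exact/cdiff_ptcont/dQ.
  move=> e e0; have e20 : 0 < e / 2 by lra.
  have [r r0 hr] := hD _ e20; exists r => // w wr.
  rewrite /Q eqxx; case: eqVneq => [_|wp]; first by rewrite subrr normr0.
  have wp0 : 0 < cmod (w - p) by rewrite normr_gt0 subr_eq0.
  have -> : (g w - g p) / (w - p) - D = (g w - g p - D * (w - p)) / (w - p).
    by field; rewrite subr_eq0.
  rewrite modM modV ltr_pdivrMr //; apply: le_lt_trans (hr _ wr) _.
  by rewrite ltr_pM2r //; lra.
have Hmean : circle_int H s = 0.
  rewrite (circle_mean hps) /H ?mul0r ?mulr0 // => z hz.
    by apply: ptcontM; [move=> e e0; exists e|exact: cQ].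
  move=> _ zp; apply: cdiffM; last exact: dQ.
  exists 1 => e e0; exists 1 => // w _.
  by rewrite mul1r subrr normr0 mulr_ge0 // ltW.
have on y : cmod (polar s y) = s by rewrite mod_polar gtr0_norm.
have ck : icont 0 T (fun y => cauchy_kernel (polar s y) p).
  apply: (@icont_circle _ (cauchy_kernel^~ p)) => z hz; apply: ptcont_kernel.
  by rewrite hz gtr0_norm.
have cgk : icont 0 T (fun y => g (polar s y) * cauchy_kernel (polar s y) p).
  apply: (@icont_circle _ (fun u => g u * cauchy_kernel u p)) => z.
  rewrite gtr0_norm // => hz.
  by apply: ptcontM; [apply/cdiff_ptcont/dg|apply: ptcont_kernel]; rewrite hz.
rewrite -(kernel_mean ps) mulrC -cintZ //.
apply/eqP; rewrite -subr_eq0 -cintB //.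
  2: by move=> y hy; apply: ptcontM; [exact: ptcont_cst|exact: ck].
apply/eqP; rewrite -[RHS]Hmean; apply: eq_cint => y _.
have pu : cmod p < cmod (polar s y) by rewrite on.
rewrite /H /Q kernelE // -subr_eq0 (negbTE (cmod_lt_neq pu)).
by field; exact: cmod_lt_neq.
Qed.

Lemma cmod_sum (I : Type) (l : seq I) (P : pred I) (F : I -> K) :
  cmod (\sum_(j <- l | P j) F j) <= \sum_(j <- l | P j) cmod (F j).
Proof.
apply: (big_ind2 (fun z x => cmod z <= x)) => //; first by rewrite normr0.
by move=> z x w y zx wy; apply: le_trans (ler_normD _ _) (lerD zx wy).
Qed.

Lemma ptcont_sum (V : normedZmodType R) (I : Type) (l : seq I) (P : pred I)
    (F : I -> V -> K) (x : V) : (forall j, ptcont (F j) x) ->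
  ptcont (fun v => \sum_(j <- l | P j) F j v) x.
Proof.
move=> cF; elim: l => [|j l IH].
  apply: (@eq_ptcont _ _ _ (fun=> 0) _ _ 1) => //; last exact: ptcont_cst.
  by move=> v _; rewrite big_nil.
apply: (@eq_ptcont _ _ _ (fun v => (if P j then F j v else 0) +
    \sum_(j <- l | P j) F j v) _ _ 1) => //.
  by move=> v _; rewrite big_cons; case: (P j); rewrite ?add0r.
by apply: ptcontD => //; case: (P j) => //; exact: ptcont_cst.
Qed.

Lemma cint_sum (I : Type) (l : seq I) a b (F : I -> R -> K) :
  (forall j, icont a b (F j)) ->
  cint a b (fun y => \sum_(j <- l) F j y) = \sum_(j <- l) cint a b (F j).
Proof.
move=> cF; elim: l => [|j l IH].
  rewrite big_nil -[RHS](mul0r (cint a b (fun=> 0))) -cintZ; last first.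
    by move=> x _; exact: ptcont_cst.
  by apply: eq_cint => y _; rewrite big_nil mul0r.
rewrite big_cons -IH -cintD //; last first.
  by move=> x hx; apply: ptcont_sum => k; exact: cF.
by apply: eq_cint => y _; rewrite big_cons.
Qed.

(** Each g_j(p_j) is the mean of g_j(u) / (1 - p_j / u) over the same circle, so
    the sum is the mean of one function of u, bounded by its worst value. *)
Lemma cauchy_sup (I : finType) (g : I -> K -> K) (p : I -> K) s rho A :
  (forall j, cmod (p j) < s < rho) ->
  (forall j z, cmod z < rho -> cdiff (g j) z) ->
  0 < s ->
  (forall y, 0 <= y <= T ->
    cmod (\sum_j g j (polar s y) * cauchy_kernel (polar s y) (p j)) <= A) ->
  cmod (\sum_j g j (p j)) <= A.
Proof.
move=> hp dg s0 hA; rewrite -(ler_pM2l (T_gt0 R)).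
have -> : T * cmod (\sum_j g j (p j)) =
  cmod (cint 0 T (fun y =>
    \sum_j g j (polar s y) * cauchy_kernel (polar s y) (p j))).
  have on y : cmod (polar s y) = s by rewrite mod_polar gtr0_norm.
  rewrite cint_sum; last first.
    move=> j.
    apply: (@icont_circle _ (fun u => g j u * cauchy_kernel u (p j))) => z.
    have /andP[ps srho] := hp j; rewrite gtr0_norm // => hz.
    by apply: ptcontM; [apply/cdiff_ptcont/dg|apply: ptcont_kernel]; rewrite hz.
  transitivity (cmod (\sum_j T%:C%C * g j (p j))).
    by rewrite -mulr_sumr modM modR gtr0_norm ?T_gt0.
  congr Num.norm; apply: eq_bigr => j _; apply/esym.
  by apply: (cauchy_circle (hp j)); exact: dg.
rewrite -[T in leRHS]subr0 mulrC; apply: cint_le; first exact/ltW/T_gt0.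
  move=> y hy; apply: ptcont_sum => j; move: y hy.
  apply: (@icont_circle _ (fun u => g j u * cauchy_kernel u (p j))) => z.
  have /andP[ps srho] := hp j; rewrite gtr0_norm // => hz.
  by apply: ptcontM; [apply/cdiff_ptcont/dg|apply: ptcont_kernel]; rewrite hz.
exact: hA.
Qed.

End Cauchy_formula.

(** * Moments of sums of signs *)

Section Binomial_moments.
Variable R : realType.
Implicit Types (a rho : R) (f : R -> R) (n k : nat).

(** The probability of exactly nu values -1 among n independent signs of mean
    a. *)
Definition bweight n nu a : R :=
  'C(n, nu)%:R * ((1 - a) / 2) ^+ nu * ((1 + a) / 2) ^+ (n - nu).

(** The expectation of f (X_1 + ... + X_n) for independent signs X_i of mean a;
    for |a| > 1 the binomial weights are signed. *)
Definition bexp n a f : R :=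
  \sum_(nu < n.+1) bweight n nu a * f (n%:R - 2 * nu%:R).

Lemma bexp0 a f : bexp 0 a f = f 0.
Proof.
by rewrite /bexp big_ord1 /bweight bin0 !expr0 !mul1r mulr0 subr0.
Qed.

Lemma eq_bexp n a f g : f =1 g -> bexp n a f = bexp n a g.
Proof. by move=> fg; apply: eq_bigr => nu _; rewrite fg. Qed.

Lemma bexpD n a f g : bexp n a (fun t => f t + g t) = bexp n a f + bexp n a g.
Proof. by rewrite -big_split; apply: eq_bigr => nu _; rewrite mulrDr. Qed.

Lemma bexpZ n a c f : bexp n a (fun t => c * f t) = c * bexp n a f.
Proof. by rewrite mulr_sumr; apply: eq_bigr => nu _; rewrite mulrCA. Qed.

Lemma bexp_sum n a m (f : 'I_m -> R -> R) :
  bexp n a (fun t => \sum_(j < m) f j t) = \sum_(j < m) bexp n a (f j).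
Proof.
by rewrite exchange_big; apply: eq_bigr => nu _; rewrite mulr_sumr.
Qed.

(** Conditioning on the last sign. *)
Lemma bexpS n a f : bexp n.+1 a f =
  (1 + a) / 2 * bexp n a (fun t => f (t + 1)) +
  (1 - a) / 2 * bexp n a (fun t => f (t - 1)).
Proof.
pose F nu := ((1 - a) / 2) ^+ nu * ((1 + a) / 2) ^+ (n.+1 - nu) *
  f (n.+1%:R - 2 * nu%:R).
have e1 : (1 + a) / 2 * bexp n a (fun t => f (t + 1)) =
    \sum_(nu < n.+2) 'C(n, nu)%:R * F nu.
  rewrite [RHS]big_ord_recr /= bin_small // mul0r addr0 mulr_sumr.
  apply: eq_bigr => nu _; rewrite /F /bweight subSn -1?ltnS // exprS.
  rewrite (_ : n.+1%:R - 2 * nu%:R = n%:R - 2 * nu%:R + 1); last first.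
    by rewrite -natr1; ring.
  by ring.
have e2 : (1 - a) / 2 * bexp n a (fun t => f (t - 1)) =
    \sum_(nu < n.+1) 'C(n, nu)%:R * F nu.+1.
  rewrite mulr_sumr; apply: eq_bigr => nu _; rewrite /F /bweight subSS exprS.
  rewrite (_ : n.+1%:R - 2 * nu.+1%:R = n%:R - 2 * nu%:R - 1); last first.
    by rewrite -!natr1; ring.
  by ring.
rewrite e1 e2 /bexp [LHS]big_ord_recl [X in _ = X + _]big_ord_recl /= !bin0.
rewrite -addrA -big_split /=; congr (_ + _).
  by rewrite /bweight /F bin0; ring.
apply: eq_bigr => nu _; rewrite /bump /= add1n /bweight binS natrD /F.
by ring.
Qed.

(** The identity E[S f(S)] = n E[X_n f(S)], which comes from the symmetry
    between the signs. *)
Lemma bexp_mul n a f : bexp n.+1 a (fun t => t * f t) = n.+1%:R *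
  ((1 + a) / 2 * bexp n a (fun t => f (t + 1)) -
   (1 - a) / 2 * bexp n a (fun t => f (t - 1))).
Proof.
have shift n' (c : R) (g : R -> R) : bexp n' a (fun t => (t + c) * g t) =
    bexp n' a (fun t => t * g t) + c * bexp n' a g.
  by rewrite -bexpZ -bexpD; apply: eq_bexp => t; rewrite mulrDl.
elim: n f => [|n IH] f; first by rewrite bexpS !bexp0; ring.
rewrite bexpS !shift !IH.
have e (c : R) : bexp n.+1 a (fun t => f (t + c)) =
    (1 + a) / 2 * bexp n a (fun t => f (t + 1 + c)) +
    (1 - a) / 2 * bexp n a (fun t => f (t - 1 + c)).
  by rewrite bexpS.
have e' : bexp n a (fun t => f (t + 1 - 1)) = bexp n a (fun t => f (t - 1 + 1)).
  by apply: eq_bexp => t; rewrite addrK subrK.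
by rewrite !e e' -(natr1 n.+1); ring.
Qed.

(** In the previous identity X_n is centred: E[(X - a) f(T + X)] is
    (1 - a^2) / 2 times the difference of the values of E[f(T + .)] at 1
    and -1. *)
Lemma bexp_center n a f : bexp n.+1 a (fun t => t * f t) =
  n.+1%:R * (a * bexp n.+1 a f + (1 - a ^+ 2) / 2 *
    (bexp n a (fun t => f (t + 1)) - bexp n a (fun t => f (t - 1)))).
Proof. by rewrite bexp_mul (bexpS n a f); congr (_ * _); field. Qed.

Lemma bexp_binomial n a (c : R) k : bexp n a (fun t => (t + c) ^+ k) =
  \sum_(j < k.+1) 'C(k, j)%:R * c ^+ j * bexp n a (fun t => t ^+ (k - j)).
Proof.
under eq_bigr do rewrite -bexpZ.
rewrite -bexp_sum; apply: eq_bexp => t; rewrite exprDn.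
by apply: eq_bigr => j _; rewrite mulrC -mulr_natl mulrA.
Qed.

Variable rho : R.
Hypothesis rho1 : 1 <= rho.
Variable a : R.
Hypothesis arho : `|a| <= rho.

(** Every mixed moment of the signs is 1 or a power of a, hence is dominated
    by the same moment of constants equal to rho. *)
Lemma bexp_moment_le n k : `|bexp n a (fun t => t ^+ k)| <= (n%:R * rho) ^+ k.
Proof.
elim: n k => [|n IH] k.
  by rewrite bexp0 mul0r normrX normr0.
have rho0 : 0 <= rho by apply: le_trans rho1.
pose m (j : nat) : R := (1 + a) / 2 + (1 - a) / 2 * (-1) ^+ j.
have mle j : `|m j| <= rho ^+ j.
  rewrite /m -signr_odd; have : `|(if odd j then a else 1 : R)| <= rho ^+ j.
    case: j => [|j]; first by rewrite normr1.
    have : rho <= rho ^+ j.+1 by rewrite ler_eXnr.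
    by move=> h; case: ifP => _; rewrite ?normr1 (le_trans _ h).
  apply: le_trans; rewrite le_eqVlt; apply/orP; left; apply/eqP.
  by congr `|_|; case: (odd j); rewrite ?expr0 ?expr1; field.
have -> : bexp n.+1 a (fun t => t ^+ k) =
    \sum_(j < k.+1) 'C(k, j)%:R * m j * bexp n a (fun t => t ^+ (k - j)).
  rewrite bexpS.
  rewrite !bexp_binomial !mulr_sumr -big_split; apply: eq_bigr => j _ /=.
  by rewrite /m expr1n; ring.
apply: le_trans (ler_norm_sum _ _ _) _.
have -> : (n.+1%:R * rho) ^+ k =
    \sum_(j < k.+1) 'C(k, j)%:R * rho ^+ j * (n%:R * rho) ^+ (k - j).
  rewrite -natr1 mulrDl mul1r exprDn; apply: eq_bigr => j _.
  by rewrite mulrC -mulr_natl mulrA.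
apply: ler_sum => j _; rewrite !normrM normr_nat.
by rewrite ler_pM ?mulr_ge0 // ler_wpM2l.
Qed.

(** The difference only involves odd powers of the unit shift, with nonnegative
    coefficients; as in bexp_moment_le it is dominated by the same expression
    with n rho in place of the sum of signs. *)
Lemma bexp_moment_diff n k :
  `|bexp n a (fun t => (t + 1) ^+ k) - bexp n a (fun t => (t - 1) ^+ k)| <=
  2 * k%:R * (n.+1%:R * rho) ^+ k.-1.
Proof.
have rho0 : 0 <= rho by apply: le_trans rho1.
have X0 : 0 <= n%:R * rho by rewrite mulr_ge0.
pose s (j : nat) : R := 1 - (-1) ^+ j.
have s0 j : 0 <= s j.
  by rewrite /s -signr_odd; case: (odd j); rewrite ?expr0 ?expr1; lra.
set X := n%:R * rho in X0.
apply: (@le_trans _ _ ((X + 1) ^+ k - (X - 1) ^+ k)).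
  rewrite !bexp_binomial -sumrB.
  have e' (c : R) : (X + c) ^+ k =
      \sum_(j < k.+1) 'C(k, j)%:R * c ^+ j * X ^+ (k - j).
    by rewrite exprDn; apply: eq_bigr => j _; rewrite mulrC -mulr_natl mulrA.
  rewrite !e' -sumrB; apply: le_trans (ler_norm_sum _ _ _) _.
  apply: ler_sum => j _; rewrite -!mulrBl -!mulrBr expr1n.
  rewrite !normrM normr_nat (ger0_norm (s0 j)).
  by rewrite ler_wpM2l ?mulr_ge0 ?s0 // bexp_moment_le.
have XS : X + 1 <= n.+1%:R * rho by rewrite -natr1 mulrDl mul1r lerD2l.
case: k => [|k]; first by rewrite !expr0 subrr mulr0 mul0r.
rewrite subrXX (_ : X + 1 - (X - 1) = 2); last ring.
rewrite -mulrA ler_wpM2l // mulr_natl.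
apply: (@le_trans _ _ (\sum_(j < k.+1) (n.+1%:R * rho) ^+ k)); last first.
  by rewrite sumr_const card_ord.
apply: ler_sum => j _ /=.
have jk : (k - j + j)%N = k by rewrite subnK // -ltnS.
rewrite -[in leRHS]jk exprD; apply: le_trans (ler_norm _) _.
rewrite normrM !normrX ler_pM ?exprn_ge0 //.
  by apply: lerXn2r; rewrite ?nnegrE ?mulr_ge0 //; rewrite ger0_norm; lra.
apply: lerXn2r; rewrite ?nnegrE ?mulr_ge0 //; apply: le_trans XS.
by rewrite ler_norml; lra.
Qed.

(** The value at a of the Bernstein polynomial of t^k, the nodes being the
    values of S / n. *)
Definition bmoment n k := bexp n a (fun t => t ^+ k) / n%:R ^+ k.

(** Apply bexp_center to f(t) = t^k. The correction carries k values of degree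
    k - 1 against the normalization n^k, hence the gain of 1 / n. *)
Lemma bmoment_step n k : (0 < n)%N ->
  `|bmoment n k.+1 - a ^+ k.+1| <=
  rho * `|bmoment n k - a ^+ k| + 2 * k%:R * rho ^+ k.+1 / n%:R.
Proof.
case: n => // n _; rewrite /bmoment.
have n0 : 0 < n.+1%:R :> R by [].
have rho0 : 0 <= rho by apply: le_trans rho1.
have -> : bexp n.+1 a (fun t => t ^+ k.+1) =
    bexp n.+1 a (fun t => t * t ^+ k).
  by apply: eq_bexp => t; rewrite exprS.
rewrite bexp_center.
set D := bexp n a _ - _; set B := bexp n.+1 a _.
have -> : n.+1%:R * (a * B + (1 - a ^+ 2) / 2 * D) / n.+1%:R ^+ k.+1 - a ^+ k.+1
  = a * (B / n.+1%:R ^+ k - a ^+ k) + (1 - a ^+ 2) / 2 * (D / n.+1%:R ^+ k).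
  have gen (N P c ak : R) : N != 0 -> P != 0 ->
      N * (a * B + c * D) / (N * P) - a * ak = a * (B / P - ak) + c * (D / P).
    by move=> N0 P0; field; rewrite N0 P0.
  by rewrite 2![_ ^+ k.+1]exprS gen // ?expf_neq0 // gt_eqF.
apply: le_trans (ler_normD _ _) _; rewrite normrM.
apply: lerD; first by rewrite ler_wpM2r.
have D0 : `|D / n.+1%:R ^+ k| <= 2 * k%:R * rho ^+ k.-1 / n.+1%:R.
  rewrite normrM normfV normrX (ger0_norm (ltW n0)) ler_pdivrMr ?exprn_gt0 //.
  apply: le_trans (bexp_moment_diff _ _) _; rewrite exprMn.
  case: k {B D} => [|k]; first by rewrite mulr0 !mul0r.
  rewrite le_eqVlt; apply/orP; left; apply/eqP.
  by rewrite /= exprS [RHS]mulrA divfK ?gt_eqF //; ring.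
have a2 : `|(1 - a ^+ 2) / 2| <= rho ^+ 2.
  have : a ^+ 2 <= rho ^+ 2.
    by rewrite -[X in X <= _]real_normK ?num_real // lerXn2r ?nnegrE.
  have := sqr_ge0 a; have : 1 <= rho ^+ 2 by rewrite expr_ge1.
  by rewrite ler_norml; lra.
rewrite normrM; apply: le_trans (ler_pM _ _ a2 D0) _ => //.
case: k {B D D0} => [|k]; first by rewrite !(mulr0, mul0r).
rewrite le_eqVlt; apply/orP; left; apply/eqP.
by rewrite /= !exprS expr0; ring.
Qed.

End Binomial_moments.

(** * Sums under a linear recursion *)

Section Feedback.
Variable R : realType.
Implicit Types (q : R) (x y : nat -> R).

(** Adding the term x_L to the left-hand side makes the inequality inductive. *)
Lemma sum_feedback q x y L : 0 <= q < 1 -> (forall k, 0 <= x k) ->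
  (forall k, x k.+1 <= q * x k + y k) ->
  (1 - q) * \sum_(k < L) x k <= x 0 + \sum_(k < L) y k.
Proof.
move=> q1 x0 xy.
suff : (1 - q) * (\sum_(k < L) x k) + x L <= x 0 + \sum_(k < L) y k.
  by have := x0 L; lra.
elim: L => [|L IH]; first by rewrite !big_ord0 mulr0 add0r addr0.
by rewrite !big_ord_recr /= mulrDr; have := xy L; lra.
Qed.

Lemma sum_geometric q L : 0 <= q < 1 -> (1 - q) * (\sum_(k < L) q ^+ k) <= 1.
Proof.
move=> q1; have /andP[q0 _] := q1.
have := @sum_feedback q (fun k => q ^+ k) (fun=> 0) L q1.
rewrite (@big1 _ _ _ _ _ _ (fun=> 0)) // addr0 expr0; apply=> k.
  exact: exprn_ge0.
by rewrite exprS addr0.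
Qed.

Lemma sum_arith_geometric q L : 0 <= q < 1 ->
  (1 - q) ^+ 2 * (\sum_(k < L) k%:R * q ^+ k) <= 1.
Proof.
move=> q1; have /andP[q0 q1'] := q1.
have := @sum_feedback q (fun k => k%:R * q ^+ k) (fun k => q ^+ k.+1) L q1.
rewrite mul0r add0r => h; rewrite expr2 -mulrA.
have {h} h1 : (1 - q) * (\sum_(k < L) k%:R * q ^+ k) <= \sum_(k < L) q ^+ k.+1.
  apply: h => k; first by rewrite mulr_ge0 // exprn_ge0.
  by rewrite -natr1 exprS; lra.
apply: le_trans (ler_wpM2l _ h1) _; first lra.
under eq_bigr do rewrite exprS.
rewrite -mulr_sumr mulrCA.
have := sum_geometric L q1.
have : 0 <= (1 - q) * (\sum_(k < L) q ^+ k).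
  apply: mulr_ge0; first lra.
  by apply: sumr_ge0 => k _; exact: exprn_ge0.
by nra.
Qed.

End Feedback.

(** * The Bernstein operator on the Cauchy kernel *)

Section Kernel_approximation.
Variable R : realType.
Local Notation K := (Rcomplex R).
Implicit Types (u z : K) (a q : R).

Lemma kernel_geometric u z L : cmod z < cmod u ->
  cauchy_kernel u z =
  \sum_(k < L) (z / u) ^+ k + (z / u) ^+ L * cauchy_kernel u z.
Proof.
move=> zu; have u0 : u != 0.
  by rewrite -(@normr_gt0 _ (Rcomplex R)) (le_lt_trans _ zu).
have h0 : 1 - z / u != 0.
  apply: contra (cmod_lt_neq zu) => /eqP h.
  by rewrite -[u - z]mulr1 -(divff u0) mulrCA mulrBl divff // h mulr0.
apply: (mulIf h0); rewrite mulrDl -mulrA /cauchy_kernel mulVf // mulr1.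
have := subrX1 (z / u) L; rewrite -opprB -[z / u - 1]opprB mulNr => /oppr_inj h.
by rewrite mulrC -h subrK.
Qed.

Lemma kernel_le u z q : 0 <= q < 1 -> 0 < cmod u -> cmod z <= q * cmod u ->
  cmod (cauchy_kernel u z) <= (1 - q)^-1.
Proof.
move=> q1 u0 zu; rewrite modV lef_pV2 ?posrE; try lra.
  have := ler_normD (1 - z / u : K) (z / u).
  rewrite subrK mod1 [cmod (z / u)]modM modV => h.
  have : cmod z / cmod u <= q by rewrite ler_pdivrMr.
  lra.
rewrite normr_gt0; apply: (@cmod_lt_neq R (z / u) 1).
by rewrite mod1 modM modV ltr_pdivrMr // mul1r; nra.
Qed.

(** Lets L tend to infinity in truncation estimates, where B may be huge: it
    will be the sum of the absolute values of the binomial weights. *)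
Lemma le_geometric_tail (X A B q : R) : 0 <= q < 1 ->
  (forall L : nat, X <= A + B * q ^+ L) -> X <= A.
Proof.
move=> q1 h; apply/ler_addgt0Pr => e e0.
have /andP[q0 _] := q1; have qn : `|q| < 1 by rewrite ger0_norm; lra.
have B0 : 0 < `|B| + 1 by rewrite ltr_wpDl.
have : 0 < e / (`|B| + 1) by exact: divr_gt0.
move/cvgrPdist_le: (cvg_expr qn) => /[apply] -[L _ /(_ L (leqnn _))] /=.
rewrite sub0r normrN ger0_norm ?exprn_ge0 //.
rewrite ler_pdivlMr // => hL; apply: le_trans (h L) _; rewrite lerD2l.
apply: le_trans hL; rewrite mulrC ler_wpM2l ?exprn_ge0 //.
by have := ler_norm B; lra.
Qed.

Lemma bexp1 n a : bexp n a (fun=> 1) = 1.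
Proof. by elim: n => [|n IH]; rewrite ?bexp0 // bexpS IH; field. Qed.

(** On the monomials of the geometric series of the kernel the error of the
    Bernstein operator obeys the recursion bmoment_step; dividing by s^k turns
    it into a contraction of ratio q = rho / s, so the errors x_k are summable,
    with a sum of order 1 / n. *)
Lemma bernstein_kernel (rho s : R) : 1 <= rho < s ->
  exists2 C : R, 0 <= C & forall n a u, (0 < n)%N -> `|a| <= rho ->
    cmod u = s ->
    cmod (\sum_(nu < n.+1) (bweight n nu a)%:C%C *
            cauchy_kernel u (1 - 2 * (nu%:R / n%:R))%:C%C
          - cauchy_kernel u a%:C%C)
    <= C / n%:R.
Proof.
move=> /andP[rho1 rhos]; have s0 : 0 < s by lra.
pose q := rho / s; have q1 : 0 <= q < 1.
  by rewrite divr_ge0 ?ltW //=; [rewrite ltr_pdivrMr // mul1r|lra].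
have /andP[q0 q1'] := q1.
exists (2 / (1 - q) ^+ 3); first by rewrite divr_ge0 // exprn_ge0 //; lra.
move=> n a u n0 arho us; have N0 : 0 < n%:R :> R by rewrite ltr0n.
pose x k := `|bmoment a n k - a ^+ k| / s ^+ k.
have xsum L : \sum_(k < L) x k <= 2 / (1 - q) ^+ 3 / n%:R.
  have x0 : x 0 = 0.
    rewrite /x /bmoment (@eq_bexp _ _ _ _ (fun=> 1)) // bexp1 !expr0 divr1.
    by rewrite divr1 subrr normr0.
  have xge k : 0 <= x k by rewrite divr_ge0 // exprn_ge0 // ltW.
  have xS k : x k.+1 <= q * x k + 2 / n%:R * q * (k%:R * q ^+ k).
    rewrite /x; have sk : 0 < s ^+ k.+1 by rewrite exprn_gt0.
    rewrite ler_pdivrMr //; apply: le_trans (bmoment_step rho1 arho k n0) _.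
    rewrite /x [leRHS]mulrDl; apply: lerD;
      rewrite le_eqVlt; apply/orP; left; apply/eqP.
      by rewrite /q exprS; field; rewrite expf_neq0 ?gt_eqF.
    rewrite /q !exprS expr_div_n; field.
    by rewrite expf_neq0 ?gt_eqF.
  have := sum_feedback L q1 xge xS; rewrite x0 add0r -mulr_sumr => h.
  have qL := sum_arith_geometric L q1.
  have c1 : 0 < 1 - q by lra.
  rewrite mulrAC ler_pdivlMr ?exprn_gt0 //.
  have -> : (\sum_(k < L) x k) * (1 - q) ^+ 3 =
    (1 - q) ^+ 2 * ((1 - q) * \sum_(k < L) x k) by ring.
  apply: le_trans (ler_wpM2l (exprn_ge0 _ (ltW c1)) h) _.
  have c2 : 0 <= 2 / n%:R * q by apply: mulr_ge0 => //; exact: divr_ge0.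
  rewrite mulrCA; apply: le_trans (ler_wpM2l c2 qL) _.
  by rewrite mulr1 ler_piMr ?divr_ge0 ?(ltW q1').
pose node (nu : nat) : R := 1 - 2 * (nu%:R / n%:R).
have nodele (nu : 'I_n.+1) : `|node nu| <= rho.
  apply: le_trans rho1; rewrite /node ler_norml.
  have : nu%:R / n%:R <= 1 :> R.
    by rewrite ler_pdivrMr // mul1r ler_nat -ltnS.
  have : 0 <= nu%:R / n%:R :> R by rewrite divr_ge0.
  by lra.
have zq (b : R) : `|b| <= rho -> cmod b%:C%C <= q * cmod u.
  by rewrite modR us /q divfK // gt_eqF.
have zu (b : R) : `|b| <= rho -> cmod b%:C%C < cmod u.
  by rewrite modR us => ?; lra.
pose W := \sum_(nu < n.+1) `|bweight n nu a|.
apply: (le_geometric_tail (B := (W + 1) / (1 - q)) q1) => L.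
pose rem (b : R) : K := (b%:C%C / u) ^+ L * cauchy_kernel u b%:C%C.
have remle b : `|b| <= rho -> cmod (rem b) <= q ^+ L / (1 - q).
  move=> hb; rewrite /rem modM modX ler_pM ?exprn_ge0 //.
    rewrite lerXn2r ?nnegrE // modM modV us modR /q.
    by rewrite ler_pM2r ?invr_gt0.
  by apply: kernel_le => //; [rewrite us|exact: zq].
have -> : \sum_(nu < n.+1)
      (bweight n nu a)%:C%C * cauchy_kernel u (node nu)%:C%C -
    cauchy_kernel u a%:C%C =
    \sum_(k < L) u^-1 ^+ k * (bmoment a n k - a ^+ k)%:C%C +
    (\sum_(nu < n.+1) (bweight n nu a)%:C%C * rem (node nu) - rem a) :> K.
  have e (nu : 'I_n.+1) :
      (bweight n nu a)%:C%C * cauchy_kernel u (node nu)%:C%C =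
      (\sum_(k < L) u^-1 ^+ k * (bweight n nu a * node nu ^+ k)%:C%C) +
      (bweight n nu a)%:C%C * rem (node nu) :> K.
    rewrite [cauchy_kernel _ _](kernel_geometric L (zu _ (nodele nu))) mulrDr.
    congr (_ + _); rewrite mulr_sumr; apply: eq_bigr => k _.
    by rewrite exprMn [in RHS]rmorphM rmorphXn mulrA mulrC.
  rewrite (eq_bigr _ (fun nu _ => e nu)) big_split /=.
  rewrite (kernel_geometric L (zu _ arho)) -/(rem a) opprD addrACA.
  congr (_ + _); rewrite exchange_big /= -sumrB; apply: eq_bigr => k _.
  rewrite -mulr_sumr -[X in _ * X](rmorph_sum (real_complex R)) /=.
  rewrite rmorphB mulrBr; congr (_ * _%:C%C - _).
    rewrite /bmoment /bexp mulr_suml; apply: eq_bigr => nu _.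
    rewrite -mulrA; congr (_ * _); rewrite /node -expr_div_n; congr (_ ^+ k).
    by field; rewrite gt_eqF.
  by rewrite exprMn rmorphXn /= mulrC.
apply: le_trans (ler_normD _ _) _; apply: lerD.
  apply: le_trans (cmod_sum _ _ _) _; apply: le_trans (xsum L).
  apply: ler_sum => k _; rewrite modM modX modV us modR /x.
  by rewrite mulrC exprVn.
apply: le_trans (ler_normB _ _) _.
have -> : (W + 1) / (1 - q) * q ^+ L =
  W * (q ^+ L / (1 - q)) + q ^+ L / (1 - q) by field; lra.
apply: lerD; last exact: remle.
apply: le_trans (cmod_sum _ _ _) _; rewrite mulr_suml; apply: ler_sum => nu _.
by rewrite modM modR ler_wpM2l // remle.
Qed.

Lemma cmod_prod_diff (I : Type) (l : seq I) (A B : I -> K) (M d : R) :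
  1 <= M -> 0 <= d <= 1 ->
  (forall j, cmod (B j) <= M) -> (forall j, cmod (A j - B j) <= d) ->
  cmod (\prod_(j <- l) A j - \prod_(j <- l) B j) <=
  (size l)%:R * d * (M + 1) ^+ size l.
Proof.
move=> M1 /andP[d0 d1] hB hAB.
have hA j : cmod (A j) <= M + 1.
  rewrite -(subrK (B j) (A j)); apply: le_trans (ler_normD _ _) _.
  by have := hB j; have := hAB j; lra.
elim: l => [|j l IH]; first by rewrite !big_nil subrr normr0 !mul0r.
rewrite !big_cons /=.
have hBl : cmod (\prod_(j <- l) B j) <= (M + 1) ^+ size l.
  elim: l {IH} => [|k l IH]; first by rewrite big_nil mod1.
  rewrite big_cons modM exprS; apply: ler_pM => //.
  by apply: le_trans (hB k) _; lra.
set a := \prod_(j <- l) A j in IH *; set b := \prod_(j <- l) B j in IH hBl *.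
have -> : A j * a - B j * b = A j * (a - b) + (A j - B j) * b by ring.
apply: le_trans (ler_normD _ _) _; rewrite !modM -natr1 !mulrDl mul1r.
apply: lerD; first by rewrite exprS mulrCA ler_pM.
apply: ler_pM => //; rewrite exprS; apply: le_trans hBl _.
by rewrite ler_peMl ?exprn_ge0 //; lra.
Qed.

Lemma sum_dffun_prod (I : finType) (T_ : I -> finType)
    (F : forall j, T_ j -> K) :
  \sum_(nu : {dffun forall j, T_ j}) \prod_j F j (nu j) =
  \prod_j \sum_(t : T_ j) F j t.
Proof.
rewrite (reindex (@dffun_of_fprod _ T_)) /=; last first.
  exact/onW_bij/dffun_of_fprod_bij.
pose P j : {ffun T_ j -> K} := [ffun t => F j t].
transitivity (\sum_(t : fprod T_) \prod_(j in I) P j (t j)).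
  by apply: eq_bigr => t _; apply: eq_bigr => j _; rewrite !ffunE.
rewrite big_fprod.
have <- := bigA_distr_big_dep (tagged_with T_) (fun j => untag 0 (P j)).
apply: eq_bigr => j _.
rewrite -(big_tag (fun j t => P j t)); apply: eq_bigr => t _.
by rewrite ffunE.
Qed.

End Kernel_approximation.

(** * Functionals on a polydisc *)

Section Polydisc.
Variables (R : realType) (m : nat).
Local Notation K := (Rcomplex R).
Local Notation T := (pi *+ 2 : R).
Implicit Types (w p u : 'I_m -> K) (f : ('I_m -> K) -> K).

Definition upd w (j : 'I_m) (z : K) : 'I_m -> K :=
  fun k => if k == j then z else w k.

(** Given by angles, so that its compactness and the mean over each of its
    circles are both immediate. *)
Definition torus (s : 'I_m -> R) : set ('I_m -> K) :=
  [set u | forall j, exists2 y, 0 <= y <= T & u j = polar (s j) y].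

Variables (s rho : 'I_m -> R).
Hypothesis srho : forall j, 0 < s j < rho j.

Lemma torus_mod u j : torus s u -> cmod (u j) = s j.
Proof.
by move=> /(_ j)[y _ ->]; rewrite mod_polar gtr0_norm //; case/andP: (srho j).
Qed.

(** The maximum principle that drives the proof. The variables are moved to the
    torus one at a time by cauchy_sup, each leaving a kernel behind; in the end
    f is only evaluated on the torus. *)
Lemma polydisc_sup (I : finType) (al : I -> K) (p : I -> 'I_m -> K) f (A : R) :
  (forall j k, cmod (p j k) < s k) ->
  (forall w k, (forall j, cmod (w j) < rho j) ->
    cdiff (fun z => f (upd w k z)) (w k)) ->
  (forall u, torus s u ->
    cmod (\sum_i al i * (\prod_j cauchy_kernel (u j) (p i j)) * f u) <= A) ->
  cmod (\sum_i al i * f (p i)) <= A.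
Proof.
move=> hp df hA.
(* The first k variables have been moved to the torus. *)
pose mix (k : nat) p u : 'I_m -> K := fun j => if (j < k)%N then u j else p j.
have mixE k p' u : torus s u -> (forall j, cmod (p' j) < s j) ->
    forall j, cmod (mix k p' u j) < rho j.
  move=> hu hp' j; have := srho j; rewrite /mix; case: ifP => _ ?.
    by rewrite torus_mod //; lra.
  by apply: lt_trans (hp' j) _; lra.
suff /(_ 0%N (leq0n _)) h : forall k, (k <= m)%N -> forall u, torus s u ->
    cmod (\sum_i al i *
      (\prod_(j < m | (j < k)%N) cauchy_kernel (u j) (p i j)) *
      f (mix k (p i) u)) <= A.
  have /h : torus s (fun j => polar (s j) 0).
    by move=> j; exists 0 => //; rewrite lexx ltW ?T_gt0.
  congr (cmod _ <= A); apply: eq_bigr => i _.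
  by rewrite big_pred0 ?mulr1 // (_ : mix 0%N (p i) _ = p i) //; apply: funext.
move=> k km; rewrite -(subKn km).
elim: (m - k)%N (leq_subr k m) => [|d IH] dm u hu.
  rewrite subn0; apply: le_trans (hA u hu); rewrite le_eqVlt; apply/orP; left.
  apply/eqP; congr Num.norm; apply: eq_bigr => i _; congr (_ * _ * f _).
    by apply: eq_bigl => j; rewrite ltn_ord.
  by apply: funext => j; rewrite /mix ltn_ord.
set k' := (m - d.+1)%N.
have k'm : (k' < m)%N by rewrite /k' ltn_subrL /= (leq_ltn_trans _ dm).
pose jk := Ordinal k'm.
have k'S : (m - d)%N = k'.+1 by rewrite /k' subnSK.
pose c i := al i * (\prod_(j < m | (j < k')%N) cauchy_kernel (u j) (p i j)).
pose g i z := c i * f (upd (mix k' (p i) u) jk z).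
have -> : \sum_i al i *
    (\prod_(j < m | (j < k')%N) cauchy_kernel (u j) (p i j)) *
    f (mix k' (p i) u) = \sum_i g i (p i jk).
  apply: eq_bigr => i _; rewrite /g /c; congr (_ * f _); apply: funext => j.
  by rewrite /upd; case: eqP => // ->; rewrite /mix ltnn.
apply: (@cauchy_sup _ _ g (p^~ jk) (s jk) (rho jk)).
- by move=> i; rewrite hp; case/andP: (srho jk).
- move=> i z hz; apply: cdiffM.
    have := cdiff_affine 0 (c i) z; apply: (@cdiff_ext _ _ _ _ 1) => // w _.
    by rewrite mul0r add0r.
  pose w0 := upd (mix k' (p i) u) jk z.
  have e z' : upd w0 jk z' = upd (mix k' (p i) u) jk z'.
    by apply: funext => j; rewrite /w0 /upd; case: eqP.
  have w0z : w0 jk = z by rewrite /w0 /upd eqxx.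
  have hw0 j : cmod (w0 j) < rho j.
    by rewrite /w0 /upd; case: eqP => [->//|_]; apply: mixE.
  have := df w0 jk hw0; rewrite w0z.
  by apply: (@cdiff_ext _ _ _ _ 1) => // w _; rewrite e.
- by case/andP: (srho jk).
move=> y hy; set z := polar (s jk) y.
have hu' : torus s (upd u jk z).
  by move=> j; rewrite /upd; case: eqP => [->|_]; [exists y|exact: hu].
have := IH (ltnW dm) _ hu'; rewrite k'S; apply: le_trans.
rewrite le_eqVlt; apply/orP; left; apply/eqP; congr Num.norm.
apply: eq_bigr => i _.
rewrite /g (bigD1 jk) /=; last by rewrite ltnS.
have -> : \prod_(j < m | (j < k'.+1)%N && (j != jk))
    cauchy_kernel (upd u jk z j) (p i j) =
    \prod_(j < m | (j < k')%N) cauchy_kernel (u j) (p i j).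
  apply: eq_big => [j|j /andP[_ /negbTE jjk]]; last by rewrite /upd jjk.
  by rewrite -val_eqE /= ltnS andbC -ltn_neqAle.
have -> : mix k'.+1 (p i) (upd u jk z) = upd (mix k' (p i) u) jk z.
  apply: funext => j; rewrite /mix /upd -val_eqE /= ltnS leq_eqVlt.
  by case: eqP.
have -> : upd u jk z jk = z by rewrite /upd eqxx.
by rewrite /c; ring.
Qed.

End Polydisc.

(** * From the normed topologies to real estimates *)

Section Topology_of_Cx.
Variable R : realType.
Local Notation K := (Rcomplex R).
Local Notation T := (pi *+ 2 : R).

Lemma normCxE (z : Cx R) : `|z| = toCx (cmod z).
Proof. by []. Qed.

Lemma toCx_gt0 (e : R) : (0 < toCx e) = (0 < e).
Proof. exact: (ltcR 0 e). Qed.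

Lemma Cx_gt0 (e : Cx R) : 0 < e -> exists2 e' : R, 0 < e' & e = toCx e'.
Proof.
by case: e => a b /andP[/eqP /= -> a0]; exists a.
Qed.

Lemma continuous_polar t : continuous (polar t : R -> Cx R).
Proof.
move=> y; apply/cvgrPdist_lt => e /Cx_gt0[e' e'0 ->].
have [d d0 hd] := ptcont_polar_angle t y e'0.
near=> y'; rewrite normCxE (ltcR (cmod _) e') distrC; apply: hd.
by near: y'; exists d => //= y'; rewrite distrC.
Unshelve. all: by end_near. Qed.

Lemma compact_torus m (s : 'I_m -> R) :
  compact [set w : 'rV[Cx R]_m | torus s (w ord0)].
Proof.
pose A j : set (Cx R) := polar (s j) @` `[0, T].
have /(rV_compact (T := Cx R)) : forall j, compact (A j).
  move=> j; apply: continuous_compact; last exact: segment_compact.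
  exact/continuous_subspaceT/continuous_polar.
congr (compact _); apply/seteqP; split => w /= h j.
  have [y /=] := h j; rewrite in_itv /= => hy <-; by exists y.
by have [y hy ->] := h j; exists y => //=; rewrite in_itv.
Qed.

(** The derivative in the direction of the j-th basis vector is a limit over
    complex increments. *)
Lemma differentiable_cdiff m (F : 'rV[Cx R]_m -> Cx R) (w : 'I_m -> K) j :
  differentiable F (\row_k (w k : Cx R)) ->
  cdiff (fun z => F (\row_k (upd w j z k : Cx R))) (w j).
Proof.
set v := \row_k _ => dF.
have {dF} := @diff_derivable _ _ _ F v (delta_mx ord0 j) dF.
rewrite /derivable => /cvg_ex[D hD]; exists D => e e0.
move/cvgrPdist_le : hD => /(_ (toCx e)); rewrite toCx_gt0 => /(_ e0).
rewrite /dnbhs /within /= => /nbhs_ballP[_ /Cx_gt0[r r0 ->]] hr.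
exists r => // z zr; have [->|zw] := eqVneq z (w j).
  by rewrite !subrr mulr0 subr0 normr0 mulr0.
have zw0 : z - w j != 0 by rewrite subr_eq0.
have zr' : ball (0 : Cx R) (toCx r) (z - w j).
  by rewrite /ball /= sub0r normrN normCxE ltcR.
have := hr _ zr' zw0; rewrite /= normCxE lecR.
have -> : (z - w j : Cx R) *: delta_mx ord0 j + v = \row_k (upd w j z k : Cx R).
  apply/rowP => k; rewrite !mxE /upd /=; case: eqVneq => [->|_].
    by rewrite mulr1 subrK.
  by rewrite mulr0 add0r.
have -> : v = \row_k (upd w j (w j) k : Cx R).
  by apply/rowP => k; rewrite !mxE /upd; case: eqP => [->|].
set Fz : K := F _; set Fw : K := F _ => h.
have -> : Fz - Fw - D * (z - w j) =
    - (D - (z - w j)^-1 * (Fz - Fw)) * (z - w j) :> K by field.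
by rewrite modM normrN ler_wpM2r.
Qed.

(** Each member is bounded on C by compactness, and in the topology of uniform
    convergence on compacts the nearby members differ from it by at most 1
    on C. *)
Lemma compact_family_bounded m (U : set 'rV[Cx R]_m) (X : topologicalType)
    (f : X -> {family compact_in U, 'rV[Cx R]_m -> Cx R})
    (C : set 'rV[Cx R]_m) (KX : set X) :
  continuous f -> compact C -> C `<=` U ->
  (forall x w, C w -> {for w, continuous (f x)}) -> compact KX ->
  exists M : R, forall x w, KX x -> C w -> cmod (f x w) <= M.
Proof.
move=> cf cC CU cfx cK.
have one_x x : exists M : R, forall w, C w -> cmod (f x w) <= M.
  have := (compact_near_coveringP C).1 cC R (nbhs +oo%R)
    (fun M w => cmod (f x w) <= M) _ _.
  case=> [w Cw|M [_ hM]]; last first.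
    have MM : M < M + 1 by rewrite ltrDl.
    by exists (M + 1) => w; exact: (hM _ MM w).
  have /cvgrPdist_le /(_ 1 ltr01) near1 := cfx x w Cw.
  exists ([set w' | `|f x w - f x w'| <= 1], [set M | cmod (f x w) + 1 <= M]).
    by split=> //=; apply: nbhs_pinfty_ge; exact: num_real.
  case=> w' M [/=]; rewrite normCxE (lecR _ 1) distrC => h1; apply: le_trans.
  rewrite -[X in cmod X <= _](subrK (f x w : K)).
  by apply: le_trans (ler_normD _ _) _; rewrite addrC lerD2l.
have := (compact_near_coveringP KX).1 cK R (nbhs +oo%R)
  (fun M x => forall w, C w -> cmod (f x w) <= M) _ _.
case=> [x Kx|M [_ hM]]; last first.
  have MM : M < M + 1 by rewrite ltrDl.
  by exists (M + 1) => x w Kx; exact: (hM _ MM x Kx w).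
have [M hM] := one_x x.
have ent : entourage [set xy : Cx R * Cx R | ball xy.1 1 xy.2].
  by rewrite -entourage_from_ballE; exists 1 => //=; exact: ltr01.
have : nbhs (f x) [set g : {family compact_in U, 'rV[Cx R]_m -> Cx R} |
    forall w, C w -> ball (f x w) 1 (g w)].
  by apply: (fam_nbhs (fam := compact_in U) (A := C) (f x) ent); split.
move=> /cf near1.
exists ([set x' | forall w, C w -> ball (f x w) 1 (f x' w)],
        [set B | M + 1 <= B]).
  by split=> //=; apply: nbhs_pinfty_ge; exact: num_real.
case=> x' B [/= h1 hB] w Cw; apply: le_trans hB.
have := h1 w Cw; rewrite /ball /= normCxE (ltcR _ 1) distrC => /ltW h.
rewrite -[X in cmod X <= _](subrK (f x w : K)).
by apply: le_trans (ler_normD _ _) _; rewrite addrC lerD // hM.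
Qed.

End Topology_of_Cx.

(** * Compact subsets of the box *)

Section Bounds.
Variable R : realType.

Lemma real_between (x : R) (r : \bar R) : (x%:E < r)%E ->
  exists2 y, x < y & (y%:E < r)%E.
Proof.
case: r => [r| |] //=; rewrite ?lte_fin => xr.
  by exists ((x + r) / 2); rewrite ?lte_fin; lra.
by exists (x + 1); rewrite ?ltry ?ltrDl.
Qed.

Lemma compact_box_bound m (X : topologicalType) (r : 'I_m -> \bar R)
    (A : set ('rV[R]_m * X)) j : (1 < r j)%E -> compact A ->
  A `<=` real_box r `*` setT ->
  exists rho : R, [/\ 1 <= rho, (rho%:E < r j)%E
    & forall p, A p -> `|p.1 ord0 j| <= rho].
Proof.
move=> r1 cA Ar.
have [A0|/nonemptyPn A0] := pselect (A !=set0); last first.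
  by exists 1; split => // p; rewrite A0.
have cf : {within A, continuous (fun p : 'rV[R]_m * X => `|p.1 ord0 j|)}.
  apply/continuous_subspaceT => p.
  apply: (@continuous_comp _ _ _ (fun p : 'rV[R]_m * X => p.1 ord0 j) Num.norm).
    apply: (@continuous_comp _ _ _ fst (fun v : 'rV[R]_m => v ord0 j)).
      exact: cvg_fst.
    exact: coord_continuous.
  exact: norm_continuous.
have [c /set_mem Ac cmax] := compact_EVT_max A0 cA cf.
have [/(_ j)/andP[c1 c2] _] := Ar c Ac.
exists (Num.max 1 `|c.1 ord0 j|); split; first by rewrite le_max lexx.
  rewrite EFin_max gt_max r1 /=.
  case: (ger0P (c.1 ord0 j)) => // _; by rewrite EFinN lteNl.
by move=> p /mem_set /cmax h; rewrite le_max h orbT.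
Qed.

End Bounds.

(** * The Bernstein operator on holomorphic functions *)

Section Bernstein_of_holomorphic.
Variables (R : realType) (m : nat).
Local Notation K := (Rcomplex R).
Implicit Types (N : 'I_m -> nat) (f : ('I_m -> K) -> K).

Lemma bernstein_node_le N nu j : (0 < N j)%N -> (nu j <= N j)%N ->
  `|bernstein_node R N nu ord0 j| <= 1.
Proof.
move=> N0 nuN; rewrite mxE ler_norml.
have N0' : 0 < (N j)%:R :> R by rewrite ltr0n.
have : (nu j)%:R / (N j)%:R <= 1 :> R by rewrite ler_pdivrMr // mul1r ler_nat.
have : 0 <= (nu j)%:R / (N j)%:R :> R by rewrite divr_ge0.
by lra.
Qed.

Definition toC_row (v : 'rV[R]_m) : 'I_m -> K := fun j => (v ord0 j)%:C%C.

Variables (rho s : 'I_m -> R).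
Hypothesis hrho : forall j, 1 <= rho j < s j.

(** Both the weights and the kernels factor over the variables, which reduces
    the estimate to bernstein_kernel in each of them. *)
Lemma bernstein_kernel_prod (e : R) : 0 < e ->
  exists n0 : nat, forall N, (forall j, (0 < N j)%N /\ (n0 <= N j)%N) ->
  forall (a : 'rV[R]_m) (u : 'I_m -> K), (forall j, `|a ord0 j| <= rho j) ->
  (forall j, cmod (u j) = s j) ->
  cmod (\sum_(nu : {dffun forall j : 'I_m, 'I_(N j).+1})
          (binomial_weight N (fun j => nu j) a)%:C%C *
          (\prod_j cauchy_kernel (u j)
             (toC_row (bernstein_node R N (fun j => nu j)) j))
        - \prod_j cauchy_kernel (u j) (toC_row a j)) <= e.
Proof.
move=> e0.
have /fin_all_exists2[C C0 hC] := fun j => bernstein_kernel (hrho j).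
pose Ct := \sum_j C j; have CtC j : C j <= Ct.
  by rewrite /Ct (bigD1 j) //= lerDl sumr_ge0.
have Ct0 : 0 <= Ct by exact: sumr_ge0.
pose q j := rho j / s j.
have q1 j : 0 <= q j < 1.
  have := hrho j => h; rewrite divr_ge0 /=; try lra.
  by rewrite ltr_pdivrMr ?mul1r; lra.
pose M := 1 + \sum_j (1 - q j)^-1.
have iq0 j : 0 <= (1 - q j)^-1 by rewrite invr_ge0; have := q1 j; lra.
have Mq j : (1 - q j)^-1 <= M.
  by rewrite /M (bigD1 j) //= addrCA lerDl addr_ge0 // sumr_ge0.
have M1 : 1 <= M by rewrite lerDl sumr_ge0.
pose l := index_enum 'I_m.
pose B := (size l)%:R * (M + 1) ^+ size l.
have B0 : 0 <= B by rewrite mulr_ge0 // exprn_ge0 //; lra.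
have CB0 : 0 <= Ct * B / e.
  by apply: divr_ge0; [exact: mulr_ge0|exact: ltW].
(* The summand Ct makes d <= 1, the other one makes d * B <= e. *)
exists (Num.bound (Ct + Ct * B / e)) => N hN a u ha hu.
set n0 := Num.bound _ in hN.
have n0big : Ct + Ct * B / e < n0%:R.
  by apply: archi_boundP; rewrite addr_ge0.
have n00 : 0 < n0%:R :> R by lra.
pose d := Ct / n0%:R.
have d01 : 0 <= d <= 1.
  by rewrite divr_ge0 //= ler_pdivrMr // mul1r; lra.
have dB : d * B <= e.
  rewrite /d mulrAC ler_pdivrMr // -ler_pdivrMl // mulrC; lra.
pose A j := \sum_(nu < (N j).+1) (bweight (N j) nu (a ord0 j))%:C%C *
  cauchy_kernel (u j) (1 - 2 * (nu%:R / (N j)%:R))%:C%C.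
have -> : \sum_(nu : {dffun forall j : 'I_m, 'I_(N j).+1})
    (binomial_weight N (fun j => nu j) a)%:C%C *
    (\prod_j cauchy_kernel (u j)
       (toC_row (bernstein_node R N (fun j => nu j)) j)) =
    \prod_j A j.
  rewrite /A -(sum_dffun_prod (fun j (nu : 'I_(N j).+1) =>
    (bweight (N j) nu (a ord0 j))%:C%C *
    cauchy_kernel (u j) (1 - 2 * (nu%:R / (N j)%:R))%:C%C)).
  apply: eq_bigr => nu _; rewrite big_split /=; congr (_ * _).
    by rewrite /binomial_weight (rmorph_prod (real_complex R)).
  by apply: eq_bigr => j _; rewrite /toC_row mxE.
apply: le_trans (cmod_prod_diff l (A := A) M1 d01 _ _) _ => [j|j|].
- have h := hrho j; apply: le_trans (Mq j); apply: kernel_le => //.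
    by rewrite hu; lra.
  by rewrite /toC_row modR hu /q divfK ?ha // gt_eqF; lra.
- have [Nj0 Njn0] := hN j; apply: le_trans (hC j _ _ _ Nj0 (ha j) (hu j)) _.
  have Nj : 0 < (N j)%:R :> R by rewrite ltr0n.
  rewrite ler_pdivrMr // /d mulrAC ler_pdivlMr //.
  by apply: ler_pM => //; rewrite ler_nat.
- by rewrite mulrAC mulrC.
Qed.

(** polydisc_sup is applied to the functional with the binomial weights at the
    nodes and the weight -1 at a. *)
Lemma bernstein_holomorphic (s' : 'I_m -> R) (M e : R) :
  (forall j, s j < s' j) -> 0 < e ->
  exists n0 : nat, forall N, (forall j, (0 < N j)%N /\ (n0 <= N j)%N) ->
  forall (a : 'rV[R]_m) f, (forall j, `|a ord0 j| <= rho j) ->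
  (forall w k, (forall j, cmod (w j) < s' j) ->
    cdiff (fun z => f (upd w k z)) (w k)) ->
  (forall u, torus s u -> cmod (f u) <= M) ->
  cmod (\sum_(nu : {dffun forall j : 'I_m, 'I_(N j).+1})
          (binomial_weight N (fun j => nu j) a)%:C%C *
          f (toC_row (bernstein_node R N (fun j => nu j)))
        - f (toC_row a)) <= e.
Proof.
move=> ss' e0; have M0 : 0 < `|M| + 1 by rewrite ltr_wpDl.
have e1 : 0 < e / (`|M| + 1) by exact: divr_gt0.
have [n0 hn0] := bernstein_kernel_prod e1.
exists n0 => N hN a f ha df fM.
have hs j : 0 < s j < s' j by have := hrho j; have := ss' j; lra.
pose D := {dffun forall j : 'I_m, 'I_(N j).+1}.
pose al (i : D + 'I_1) : K := match i with
  | inl nu => (binomial_weight N (fun j => nu j) a)%:C%C | inr _ => -1 end.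
pose p (i : D + 'I_1) : 'I_m -> K := match i with
  | inl nu => toC_row (bernstein_node R N (fun j => nu j))
  | inr _ => toC_row a end.
have sumE (F : ('I_m -> K) -> K) : \sum_i al i * F (p i) =
    \sum_(nu : D) (binomial_weight N (fun j => nu j) a)%:C%C *
      F (toC_row (bernstein_node R N (fun j => nu j))) - F (toC_row a).
  by rewrite big_sumType /= big_ord1 mulN1r.
rewrite -sumE; apply: (polydisc_sup hs) => // [[nu|t] k|u hu].
- rewrite /p /toC_row modR; have := hrho k.
  have := @bernstein_node_le N (fun j => nu j) k (hN k).1 _.
  by rewrite -ltnS ltn_ord => /(_ isT); lra.
- by rewrite /p /toC_row modR; have := hrho k; have := ha k; lra.
have := sumE (fun w => (\prod_j cauchy_kernel (u j) (w j)) * f u).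
rewrite /= => h.
have {h} -> : \sum_i al i * \prod_j cauchy_kernel (u j) (p i j) * f u =
  (\sum_(nu : D) (binomial_weight N (fun j => nu j) a)%:C%C *
     (\prod_j cauchy_kernel (u j)
        (toC_row (bernstein_node R N (fun j => nu j)) j))
   - \prod_j cauchy_kernel (u j) (toC_row a j)) * f u.
  transitivity (\sum_i al i * (\prod_j cauchy_kernel (u j) (p i j) * f u)).
    by apply: eq_bigr => i _; rewrite mulrA.
  rewrite h mulrBl mulr_suml; congr (_ - _).
  by apply: eq_bigr => nu _; rewrite mulrA.
have hu' j : cmod (u j) = s j by exact: (torus_mod hs).
rewrite modM.
apply: le_trans (ler_pM _ _ (hn0 N hN a u ha hu') (fM u hu)) _ => //.
apply: (@le_trans _ _ (e / (`|M| + 1) * (`|M| + 1))).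
  by rewrite ler_pM2l //; have := ler_norm M; lra.
by rewrite divfK // gt_eqF.
Qed.

End Bernstein_of_holomorphic.

(** * Locally uniform convergence *)

Theorem theorem3p1 (R : realType) (m : nat) (hm : (0 < m)%N) (X : metricType R)
    (r : 'I_m -> \bar R) (hr : forall j, (1 < r j)%E)
    (phi : 'rV[R]_m * X -> Cx R)
    (hphi : {within real_box r `*` [set: X], continuous phi})
    (hf : exists f : X -> compact_cvg_space R m (polydisc r),
        [/\ continuous f,
            forall x, holomorphic_on (polydisc r) (f x)
          & forall x a, real_box r a ->
              phi (a, x) = f x (map_mx (@toCx R) a)])
    (K : set ('rV[R]_m * X)) (hK : compact K)
    (hKr : K `<=` real_box r `*` [set: X]) :
  {uniform K, bernstein_sum phi N @[N --> @min_infty m] --> phi}.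
Proof.
have [f [cf df fphi]] := hf.
have /fin_all_exists[rho hrho] := fun j => compact_box_bound (hr j) hK hKr.
have /fin_all_exists2[s rs sr] :
    forall j, exists2 y, rho j < y & (y%:E < r j)%E.
  by move=> j; apply: real_between; case: (hrho j).
have /fin_all_exists2[s' ss' s'r] :
    forall j, exists2 y, s j < y & (y%:E < r j)%E.
  by move=> j; apply: real_between.
have rho1 j : 1 <= rho j < s j by rewrite rs; case: (hrho j) => ->.
have s0 j : 0 < s j < s' j by rewrite ss' andbT; have := rho1 j; lra.
pose C := [set w : 'rV[Cx R]_m | torus s (w ord0)].
have small_in (w : 'I_m -> Rcomplex R) : (forall j, cmod (w j) < s' j) ->
    polydisc r (\row_j (w j : Cx R)).
  by move=> hw j; rewrite mxE; apply: lt_trans (s'r j); rewrite lte_fin hw.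
have rowE (w : 'rV[Cx R]_m) : w = \row_j w ord0 j.
  by apply/rowP => j; rewrite mxE.
have CU : C `<=` polydisc r.
  move=> w Cw; rewrite (rowE w); apply: small_in => j.
  by rewrite (torus_mod s0 _ Cw).
have cKX : compact (snd @` K).
  apply: continuous_compact hK; apply/continuous_subspaceT => p.
  exact: cvg_snd.
have cT : compact C := @compact_torus R m s.
have [M hM] := compact_family_bounded cf cT CU
  (fun x w Cw => differentiable_continuous (df x w (CU w Cw))) cKX.
move=> P /uniform_nbhs[E [+ EP]]; rewrite -entourage_from_ballE.
move=> [_ /Cx_gt0[e e0 ->] hE].
have e20 : 0 < e / 2 by lra.
have [n0 hn0] := bernstein_holomorphic rho1 M ss' e20.
exists n0 => // N hN; apply: EP => -[a x] Kax; apply: hE.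
have [/= abox _] := hKr _ Kax.
pose F (w : 'I_m -> Rcomplex R) : Rcomplex R := f x (\row_j (w j : Cx R)).
have FE (v : 'rV[R]_m) : real_box r v -> phi (v, x) = F (toC_row v).
  move=> /fphi ->; congr (f x _); apply/rowP => j; by rewrite !mxE.
rewrite /ball /= distrC normCxE ltcR.
have -> : bernstein_sum phi N (a, x) =
    \sum_(nu : {dffun forall j : 'I_m, 'I_(N j).+1})
      (binomial_weight N (fun j => nu j) a)%:C%C *
      F (toC_row (bernstein_node R N (fun j => nu j))).
  apply: eq_bigr => nu _; congr (_ * _); apply: FE => j.
  have nuN : (nu j <= N j)%N by rewrite -ltnS.
  have := @bernstein_node_le R m N (fun j => nu j) j (hN j).1 nuN.
  rewrite ler_norml.
  have [h1 h2 _] := hrho j; move=> /andP[b1 b2]; apply/andP; split.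
    rewrite lteNl; apply: le_lt_trans (hr j); rewrite lee_fin; lra.
  by apply: le_lt_trans (hr j); rewrite lee_fin.
rewrite (FE a abox).
apply: (@le_lt_trans _ _ (e / 2)); last lra.
apply: (hn0 N hN a F) => [j|w k hw|u hu].
- by have [_ _ /(_ _ Kax)] := hrho j.
- by apply: differentiable_cdiff; apply: df; exact: small_in.
- apply: hM; first by exists (a, x).
  by move=> j; rewrite mxE; exact: hu.
Qed.
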